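(* Let $\omega=(T,c,T_1,\dots,T_m,c_1,\dots,c_m,\alpha_1,\dots,\alpha_m)\in\Omega$ be such that $\langle x,Tx\rangle$ is a Legendre form on $\mathcal H$. The following four statements are equivalent: ($\beta_1$) the solution map $\mathrm{Sol}(\cdot):\Omega\rightrightarrows\mathcal H$ is lower semicontinuous at $\omega$; ($\beta_2$) the solution map $\mathrm{Sol}(\cdot)$ is continuous at $\omega$; ($\beta_3$) $\mathrm{Sol}(\omega)$ is a singleton and the optimal value function $\varphi(\cdot)$ is Lipschitz continuous around $\omega$; ($\beta_4$) $\mathrm{Sol}(\omega)$ is a singleton and the optimal value function $\varphi(\cdot)$ is continuous at $\omega$.
   Context: $\mathcal H$ is a real Hilbert space with inner product $\langle\cdot,\cdot\rangle$ and norm $\|\cdot\|$; $\mathcal L(\mathcal H)$ is the space of continuous linear operators on $\mathcal H$ with the operator norm; $m\geqslant 1$ is a fixed integer. $\Omega$ is the set of all $\omega=(T,c,T_1,\dots,T_m,c_1,\dots,c_m,\alpha_1,\dots,\alpha_m)\in \mathcal L(\mathcal H)\times\mathcal H\times\mathcal L(\mathcal H)^m\times\mathcal H^m\times\mathbb R^m$ such that $T$ is self-adjoint and each $T_i$ is self-adjoint and positive semidefinite. Product spaces carry the max norm, so $\|\omega-\omega'\|$ is the maximum of the norms of the componentwise differences. For $\omega\in\Omega$ and $x\in\mathcal H$: $f(x,\omega)=\frac12\langle x,Tx\rangle+\langle c,x\rangle$; $g_i(x,\omega)=\frac12\langle x,T_ix\rangle+\langle c_i,x\rangle+\alpha_i$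 for $i=1,\dots,m$; $F(\omega)=\{x\in\mathcal H: g_i(x,\omega)\leqslant 0,\ i=1,\dots,m\}$. The optimal value function $\varphi:\Omega\to\mathbb R\cup\{\pm\infty\}$ is $\varphi(\omega)=\inf\{f(x,\omega):x\in F(\omega)\}$ (possibly $-\infty$) if $F(\omega)\ne\emptyset$, and $\varphi(\omega)=+\infty$ if $F(\omega)=\emptyset$. The solution set is $\mathrm{Sol}(\omega)=\{x\in F(\omega): f(x,\omega)=\varphi(\omega)\}$. Continuity of $\varphi$ at $\omega$ means $\varphi(\omega^k)\to\varphi(\omega)$ for every sequence $\omega^k\to\omega$ in $\Omega$. $\varphi$ is Lipschitz continuous around $\omega$ if there are $\varepsilon>0$ and $k\geqslant 0$ such that $\varphi$ is finite on $\{\omega'\in\Omega:\|\omega'-\omega\|<\varepsilon\}$ and $|\varphi(\omega^1)-\varphi(\omega^2)|\leqslant k\|\omega^1-\omega^2\|$ for all $\omega^1,\omega^2$ in this set. A quadratic form $Q:\mathcal H\to\mathbb R$ is a Legendre form if it is weakly (sequentially) lower semicontinuous and $x_k\to x_0$ in norm whenever $x_k$ converges weakly to $x_0$ and $Q(x_k)\to Q(x_0)$. A set-valued map $S:\Omega\rightrightarrows\mathcal H$ is upper semicontinuous at $\omega$ if for each (norm-)open $V\subset\mathcal H$ with $S(\omega)\subset V$ there is $\varepsilon>0$ such that $S(\omega')\subset V$ for all $\omega'\in\Omega$ with $\|\omega'-\omega\|<\varepsilon$; it is lower semicontinuous at $\omega$ if for each open $V\subset\mathcal H$ with $S(\omega)\cap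 V\ne\emptyset$ there is $\varepsilon>0$ such that $S(\omega')\cap V\neq\emptyset$ for all $\omega'\in\Omega$ with $\|\omega'-\omega\|<\varepsilon$; it is continuous at $\omega$ if it is both upper and lower semicontinuous at $\omega$.
   Formalization: The formal theorem additionally assumes that Sol(ω) is nonempty; when Sol(ω) is empty, lower semicontinuity (β1) holds vacuously while (β3) and (β4) fail, so the equivalence as stated is false at every such ω. *)

(* Defs.v *)
From HB Require Import structures.
From mathcomp Require Import all_boot all_order all_algebra.
From mathcomp Require Import all_classical all_reals all_analysis.

Set Implicit Arguments.
Unset Strict Implicit.
Unset Printing Implicit Defensive.

Import Order.TTheory GRing.Theory Num.Theory.
Import numFieldNormedType.Exports.

Local Open Scope classical_set_scope.
Local Open Scope ring_scope.

HB.mixin Record CompleteNormedModule_isHilbert (R : realType) H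
    & CompleteNormedModule R H := {
  inner : {dot H for idfun} ;
  inner_norm : forall x : H, inner x x = `|x| ^+ 2 }.

#[short(type="hilbertType")]
HB.structure Definition Hilbert (R : realType) :=
  {H of CompleteNormedModule R H & CompleteNormedModule_isHilbert R H}.

Notation "'[ x , y ]" := (inner x y) : ring_scope.

Section HilbertNotions.
Context {R : realType} {H : hilbertType R}.

Definition opnorm (A : H -> H) : R :=
  sup [set `|A x| | x in [set x : H | `|x| <= 1]].

Definition self_adjoint (A : H -> H) : Prop :=
  forall x y : H, '[A x, y] = '[x, A y].

Definition pos_semidefinite (A : H -> H) : Prop :=
  forall x : H, 0 <= '[x, A x].

Definition weakly_cvg (x : nat -> H) (l : H) : Prop :=
  forall y : H, '[x n, y] @[n --> \oo] --> '[l, y].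

(* The lower limit is taken in \bar R: limn_inf on real sequences is only
   meaningful when the lower limit is finite. *)
Definition weakly_seq_lsc (Q : H -> R) : Prop :=
  forall (x : nat -> H) (l : H), weakly_cvg x l ->
    ((Q l)%:E <= limn_einf (fun n => (Q (x n))%:E))%E.

Definition legendre_form (Q : H -> R) : Prop :=
  weakly_seq_lsc Q /\
  (forall (x : nat -> H) (l : H), weakly_cvg x l ->
     Q (x n) @[n --> \oo] --> Q l -> x n @[n --> \oo] --> l).

End HilbertNotions.

Record Omega (R : realType) (H : hilbertType R) (m : nat) := MkOmega {
  om_T : {linear H -> H} ;
  om_c : H ;
  om_Ti : 'I_m -> {linear H -> H} ;
  om_ci : 'I_m -> H ;
  om_alpha : 'I_m -> R ;
  om_T_continuous : continuous om_T ;
  om_T_self_adjoint : self_adjoint om_T ;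
  om_Ti_continuous : forall i, continuous (om_Ti i) ;
  om_Ti_self_adjoint : forall i, self_adjoint (om_Ti i) ;
  om_Ti_psd : forall i, pos_semidefinite (om_Ti i) }.

Section Problem.
Context {R : realType} {H : hilbertType R} {m : nat}.
Implicit Types (w : Omega H m) (x : H).

Definition om_dist w w' : R :=
  Num.max (opnorm (fun x => om_T w x - om_T w' x))
 (Num.max `|om_c w - om_c w'|
  (\big[Num.max/0]_(i < m)
     Num.max (opnorm (fun x => om_Ti w i x - om_Ti w' i x))
    (Num.max `|om_ci w i - om_ci w' i| `|om_alpha w i - om_alpha w' i|))).

Definition obj x w : R := 2^-1 * '[x, om_T w x] + '[om_c w, x].

Definition constr (i : 'I_m) x w : R :=
  2^-1 * '[x, om_Ti w i x] + '[om_ci w i, x] + om_alpha w i.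

Definition feasible w : set H := [set x | forall i, constr i x w <= 0].

(* ereal_inf set0 = +oo, which is the convention for an empty feasible set. *)
Definition optval w : \bar R := ereal_inf [set (obj x w)%:E | x in feasible w].

Definition Sol w : set H := [set x | feasible w x /\ (obj x w)%:E = optval w].

Definition om_cvg (u : nat -> Omega H m) w : Prop :=
  om_dist (u n) w @[n --> \oo] --> (0 : R).

Definition optval_continuous_at w : Prop :=
  forall u : nat -> Omega H m, om_cvg u w ->
    optval (u n) @[n --> \oo] --> optval w.

Definition optval_lipschitz_around w : Prop :=
  exists e k : R, [/\ 0 < e, 0 <= k,
    forall w', om_dist w' w < e -> optval w' \is a fin_num &
    forall w1 w2, om_dist w1 w < e -> om_dist w2 w < e ->
      (`|optval w1 - optval w2| <= (k * om_dist w1 w2)%:E)%E].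

Definition usc_at (S : Omega H m -> set H) w : Prop :=
  forall V : set H, open V -> S w `<=` V ->
    exists2 e : R, 0 < e & forall w', om_dist w' w < e -> S w' `<=` V.

(* Vacuously true when S w is empty. *)
Definition lsc_at (S : Omega H m -> set H) w : Prop :=
  forall V : set H, open V -> S w `&` V !=set0 ->
    exists2 e : R, 0 < e & forall w', om_dist w' w < e -> S w' `&` V !=set0.

Definition continuous_map_at (S : Omega H m -> set H) w : Prop :=
  usc_at S w /\ lsc_at S w.

Definition is_singleton (A : set H) : Prop := exists x, A = [set x].

End Problem.

(* Main.v *)
Require Import Defs.
From HB Require Import structures.
From mathcomp Require Import all_boot all_order all_algebra.
From mathcomp Require Import all_classical all_reals all_analysis.
From mathcomp Require Import ring lra.

(** All four statements are equivalent, for data with a solution, to one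
    regularity property together with uniqueness of the solution.  Call the
    data regular when
      - (recession) no nonzero [v] with [T_i v = 0] and [<c_i, v> <= 0] for all
        [i] satisfies [<v, T v> <= 0], and
      - (Slater) some point satisfies all the constraints strictly.

    Necessity.  Regularity follows as soon as the optimal value is finite on a
    neighbourhood of the data, which each of the four statements provides.  If
    Slater fails, raising all the [alpha_i] slightly empties the feasible set
    and the value becomes [+oo] ([finite_near_slater]).  If some [v != 0]
    violates the recession property, then subtracting a small multiple of the
    rank-one operator [<v, _> v] from [T] makes the objective strictly concave
    along a feasible half-line, and the value becomes [-oo]
    ([finite_near_recession]).  Lower semicontinuity of [Sol] moreover forces
    uniqueness: tilting [c] along [x1 - x2] drives all solutions away from [x1]
    ([lsc_singleton]).

    Sufficiency.  The Legendre property enters through one inequality: there are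
    [d > 0], [C >= 0] and finitely many vectors [e_i] such that
        [d |x|^2 <= <x, T x> + C sum_i <e_i, x>^2]
    ([legendre_garding]).  Otherwise one could build inductively an orthonormal
    sequence with [<x_n, T x_n> < 1/(n+1)]; by Bessel it tends weakly to [0],
    weak lower semicontinuity gives [<x_n, T x_n> --> 0], and the Legendre
    property would make it converge in norm to [0].  This inequality survives
    small perturbations of [T], and it gives quantitative weak lower
    semicontinuity, where the defect controls [|x_n - v|^2]
    ([garding_weak_lsc]).  Weak limits of bounded sequences are taken along an
    ultrafilter, which together with the Riesz theorem avoids subsequences
    ([ultra_weak_lim]).

    With these tools the recession property self-improves to a coercive
    inequality with a penalty for leaving the recession cone
    ([recession_coercive]), so the solutions of all nearby problems lie in one
    ball ([sublevel_bounded]), nearby problems are solvable ([Sol_nonempty]),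
    and Slater points allow to repair almost feasible points at linear cost,
    which makes the value Lipschitz ([regular_stable]).  If the solution is
    unique, weak limits of solutions of approaching problems are that solution,
    and the defect term makes the convergence strong ([regular_continuous]). *)

Set Implicit Arguments.
Unset Strict Implicit.
Unset Printing Implicit Defensive.

Import Order.TTheory GRing.Theory Num.Theory.
Import numFieldNormedType.Exports.

Local Open Scope classical_set_scope.
Local Open Scope ring_scope.

(** * Inner products and operator norms *)

Section Inner.
Context {R : realType} {H : hilbertType R}.
Implicit Types x y z : H.

Lemma innerDl x y z : '[x + y, z] = '[x, z] + '[y, z].
Proof. exact: linearDl. Qed.
Lemma innerDr x y z : '[x, y + z] = '[x, y] + '[x, z].
Proof. exact: linearDr. Qed.
Lemma innerZl a x y : '[a *: x, y] = a * '[x, y].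
Proof. exact: linearZl_LR. Qed.
Lemma innerZr a x y : '[x, a *: y] = a * '[x, y].
Proof. exact: linearZr_LR. Qed.
Lemma innerC x y : '[x, y] = '[y, x].
Proof. by rewrite (hermC inner x y) /= expr0 mul1r. Qed.
Lemma innerNl x y : '[- x, y] = - '[x, y].
Proof. exact: linearNl. Qed.
Lemma innerNr x y : '[x, - y] = - '[x, y].
Proof. exact: linearNr. Qed.
Lemma inner0l y : '[0, y] = 0 :> R.
Proof. exact: linear0l. Qed.
Lemma inner0r y : '[y, 0] = 0 :> R.
Proof. exact: linear0r. Qed.
Lemma innerBl x y z : '[x - y, z] = '[x, z] - '[y, z].
Proof. exact: linearBl. Qed.
Lemma innerBr x y z : '[x, y - z] = '[x, y] - '[x, z].
Proof. exact: linearBr. Qed.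

Lemma normD2 x y : `|x + y| ^+ 2 = `|x| ^+ 2 + 2 * '[x, y] + `|y| ^+ 2.
Proof. rewrite -!inner_norm innerDl !innerDr (innerC y x); ring. Qed.

Lemma normB2 x y : `|x - y| ^+ 2 = `|x| ^+ 2 - 2 * '[x, y] + `|y| ^+ 2.
Proof. rewrite -!inner_norm innerBl !innerBr (innerC y x); ring. Qed.

(** Minimise over [t]: at [t = - b / c] the value is [a - b ^+ 2 / c].  Both
    Cauchy-Schwarz inequalities below and the optimality condition in [riesz]
    are instances. *)
Lemma nonneg_quadratic_discr (a b c : R) : 0 <= c ->
  (forall t : R, 0 <= a + 2 * b * t + c * t ^+ 2) -> b ^+ 2 <= a * c.
Proof.
move=> c0 P; have [c00|cn0] := eqVneq c 0.
  have [->|bn0] := eqVneq b 0; first by rewrite c00 mulr0 expr0n.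
  have := P (- (a + 1) / (2 * b)).
  have -> : a + 2 * b * (- (a + 1) / (2 * b)) + c * (- (a + 1) / (2 * b)) ^+ 2
    = - 1 by rewrite c00; field.
  lra.
have cp : 0 < c by rewrite lt_def cn0.
have := P (- b / c).
have -> : a + 2 * b * (- b / c) + c * (- b / c) ^+ 2 = (a * c - b ^+ 2) / c.
  by field.
by rewrite pmulr_lge0 ?invr_gt0// subr_ge0.
Qed.

Lemma cauchy_schwarz x y : `|'[x, y]| <= `|x| * `|y|.
Proof.
rewrite -(@ler_pXn2r _ 2)// ?nnegrE ?mulr_ge0// real_normK ?num_real// exprMn.
apply: nonneg_quadratic_discr => [|t]; first exact: sqr_ge0.
have -> : `|x| ^+ 2 + 2 * '[x, y] * t + `|y| ^+ 2 * t ^+ 2 = `|x + t *: y| ^+ 2.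
  by rewrite normD2 innerZr normrZ exprMn real_normK ?num_real//; ring.
exact: sqr_ge0.
Qed.

Lemma inner_ge x y : - (`|x| * `|y|) <= '[x, y].
Proof. by have := cauchy_schwarz x y; rewrite ler_norml => /andP[]. Qed.

Lemma inner_le x y : '[x, y] <= `|x| * `|y|.
Proof. exact: le_trans (ler_norm _) (cauchy_schwarz x y). Qed.

(** Cauchy-Schwarz for the positive semidefinite form of [A], applied to [x]
    and [A x]. *)
Lemma psd_form_eq0 (A : {linear H -> H}) x :
  self_adjoint A -> pos_semidefinite A -> '[x, A x] <= 0 -> A x = 0.
Proof.
move=> Asa Apsd Ax0; apply/normr0_eq0/eqP; rewrite -sqrf_eq0 -inner_norm.
have xAx : '[x, A x] = 0 by apply/le_anti; rewrite Ax0 Apsd.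
have : '[A x, A x] ^+ 2 <= '[x, A x] * '[A x, A (A x)].
  apply: nonneg_quadratic_discr => [|t]; first exact: Apsd.
  have := Apsd (x + t *: A x); congr (_ <= _).
  rewrite linearD linearZ/= innerDl !innerDr !innerZl !innerZr.
  by rewrite -(Asa x (A x)); ring.
by rewrite xAx mul0r => /(conj (sqr_ge0 _))/andP/le_anti/esym/eqP; rewrite sqrf_eq0.
Qed.

Lemma opnorm_le (A : H -> H) (M : R) : 0 <= M ->
  (forall x, `|A x| <= M * `|x|) -> opnorm A <= M.
Proof.
move=> M0 AM; apply: ge_sup; first by exists `|A 0|, 0 => //=; rewrite normr0 ler01.
move=> _ [x /= x1 <-]; apply: le_trans (AM x) _.
by rewrite -[leRHS]mulr1 ler_wpM2l.
Qed.

(** [opnorm] is a real supremum, hence junk on unbounded maps: a bound has to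
    be known beforehand. *)
Lemma le_opnorm (A : H -> H) (M : R) x :
  (forall a y, A (a *: y) = a *: A y) -> (forall y, `|A y| <= M * `|y|) ->
  `|A x| <= opnorm A * `|x|.
Proof.
move=> AZ AM; have [->|x0] := eqVneq x 0.
  by rewrite -[in A _](scale0r (0 : H)) AZ scale0r !normr0 mulr0.
have nx0 : 0 < `|x| by rewrite normr_gt0.
rewrite -ler_pdivrMr//.
have -> : `|A x| / `|x| = `|A (`|x|^-1 *: x)|.
  by rewrite AZ normrZ ger0_norm ?invr_ge0// mulrC.
apply: ub_le_sup.
  exists `|M| => _ [y /= y1 <-]; apply: le_trans (AM y) _.
  apply: le_trans (ler_norm _) _; rewrite normrM normr_id.
  by rewrite -[leRHS]mulr1 ler_wpM2l.
exists (`|x|^-1 *: x) => //=.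
by rewrite normrZ ger0_norm ?invr_ge0// mulVf ?gt_eqF.
Qed.

Lemma continuous_linear_bound (A : {linear H -> H}) : continuous A ->
  exists2 M, 0 <= M & forall x, `|A x| <= M * `|x|.
Proof.
move=> /linear_bounded_continuous/linear_boundedP/pinfty_ex_gt0[M M0 AM].
by exists M => //; exact: ltW.
Qed.

Lemma opnorm_subC (A B : H -> H) :
  opnorm (fun x => A x - B x) = opnorm (fun x => B x - A x).
Proof. by congr sup; apply: eq_imagel => x _; rewrite distrC. Qed.

End Inner.

(** * Weak limits along ultrafilters *)

Section WeakLimits.
Context {R : realType} {H : hilbertType R}.
Implicit Types x y z : H.

Lemma invS_small (e : R) : 0 < e -> \forall n \near \oo, n.+1%:R^-1 < e.
Proof. by move=> e0; exact: near_infty_natSinv_lt (PosNum e0). Qed.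

(** The representing vector is the minimiser of [J y = |y|^2 - 2 l y].  By the
    parallelogram law [|a - b|^2 <= 2 (J a + J b) - 4 inf J], so minimising
    sequences are Cauchy and completeness gives the minimiser. *)
Lemma riesz (l : H -> R) (M : R) : 0 <= M ->
  (forall a x y, l (a *: x + y) = a * l x + l y) ->
  (forall x, `|l x| <= M * `|x|) -> exists v, forall y, l y = '[v, y].
Proof.
move=> M0 llin lM.
pose J y : R := `|y| ^+ 2 - 2 * l y.
have Jge y : - M ^+ 2 <= J y.
  rewrite /J; have := lM y; rewrite ler_norml => /andP[_ h].
  have := sqr_ge0 (`|y| - M); nra.
pose g := inf (range J).
have hJ : has_inf (range J).
  by split; [exists (J 0), 0|exists (- M ^+ 2) => _ [y _ <-]].
have gJ y : g <= J y by apply: ge_inf; [case: hJ|exists y].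
have ex_v k : exists v, J v < g + k.+1%:R^-1.
  have k0 : 0 < k.+1%:R^-1 :> R by rewrite invr_gt0.
  by have [_ [v _ <-] vg] := inf_adherent k0 hJ; exists v.
pose v k := projT1 (cid (ex_v k)).
have vg k : J (v k) < g + k.+1%:R^-1 := projT2 (cid (ex_v k)).
have par a b : `|a - b| ^+ 2 <= 2 * (J a + J b) - 4 * g.
  have := gJ (2^-1 *: a + (2^-1 *: b + 0)).
  rewrite /J !llin.
  have -> : l 0 = 0.
    by have := llin 1 0 0; rewrite scale1r addr0 mul1r => h; lra.
  rewrite addr0 normD2 innerZl innerZr !normrZ !exprMn normB2.
  rewrite (ger0_norm (_ : 0 <= 2^-1))//.
  lra.
have cv : cvg (v k @[k --> \oo]).
  apply/cauchy_cvgP/cauchy_ballP => e e0.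
  have e8 : 0 < e ^+ 2 / 4 by rewrite divr_gt0// exprn_gt0.
  near_simpl; near=> p q; rewrite -ball_normE /=.
  rewrite -(@ltr_pXn2r _ 2)// ?nnegrE ?(ltW e0)//.
  apply: le_lt_trans (par _ _) _.
  have := vg p; have := vg q.
  have : p.+1%:R^-1 < e ^+ 2 / 4 by near: p; exact: invS_small.
  have : q.+1%:R^-1 < e ^+ 2 / 4 by near: q; exact: invS_small.
  move: (J (v p)) (J (v q)) p.+1%:R^-1 q.+1%:R^-1 => a b c d; lra.
pose u : H := lim (v k @[k --> \oo]).
have cvu : v k @[k --> \oo] --> u by exact: cv.
exists u => y.
have key t : 0 <= 0 + 2 * ('[u, y] - l y) * t + `|y| ^+ 2 * t ^+ 2.
  apply/ler_addgt0Pl => e e0.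
  have [K _] : \forall k \near \oo, k.+1%:R^-1 + 2 * (`|u - v k| * (`|t| * `|y|)) < e.
    pose d := e / 2 / (1 + 2 * (`|t| * `|y|)).
    have p0 : 0 <= `|t| * `|y| by rewrite mulr_ge0.
    have d0 : 0 < d by rewrite /d !divr_gt0//; lra.
    near=> k.
    have h1 : k.+1%:R^-1 < e / 2 by near: k; apply: invS_small; rewrite divr_gt0.
    have h2 : `|u - v k| < d by near: k; exact: (cvgr_dist_lt _ _ cvu).
    have h3 : d * (2 * (`|t| * `|y|)) < e / 2.
      rewrite /d mulrAC ltr_pdivrMr; last by lra.
      by rewrite ltr_pM2l ?divr_gt0//; lra.
    have := ler_wpM2r p0 (ltW h2).
    by move: h1 h3; move: k.+1%:R^-1 => a; lra.
  move=> /(_ K (leqnn K)); set k := K => hk.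
  have := gJ (t *: y + v k); rewrite /J llin addrC normD2 innerZl normrZ exprMn.
  rewrite real_normK ?num_real// (innerC y).
  have := vg k; rewrite /J.
  have := inner_le (v k - u) (t *: y).
  rewrite innerBl !innerZr normrZ (distrC (v k)).
  by move: hk; set d := k.+1%:R^-1; lra.
have := nonneg_quadratic_discr (sqr_ge0 _) key.
rewrite mul0r => /(conj (sqr_ge0 _))/andP/le_anti/esym/eqP.
by rewrite sqrf_eq0 subr_eq0 => /eqP.
Unshelve. all: by end_near. Qed.

Definition weak_lim (I : Type) (U : set_system I) (x : I -> H) v :=
  forall y (e : R), 0 < e -> \forall n \near U, `|'[x n - v, y]| < e.

Lemma ultra_fmap (I J : Type) (U : set_system I) (g : I -> J) :
  UltraFilter U -> UltraFilter (g @ U).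
Proof.
move=> UU; split=> [|G GF gUG]; first exact: fmap_proper_filter.
apply/predeqP => A; split=> [GA|]; last exact: gUG.
have [//|UnA] := in_ultra_setVsetC (g @^-1` A) UU.
have GAA : G (A `&` ~` A) by apply: (@filterI _ G _ _ _ GA); exact: gUG.
by have [a [Aa nAa]] := filter_ex GAA; case: (nAa Aa).
Qed.

(** Each [<x n, y>] stays in a compact interval, so it converges along the
    ultrafilter; the limit is a bounded linear functional of [y], represented by
    the Riesz theorem. *)
Lemma ultra_weak_lim (I : Type) (U : set_system I) (x : I -> H) (M : R) :
  UltraFilter U -> (forall n, `|x n| <= M) -> exists v, weak_lim U x v.
Proof.
move=> UU xM.
have [i _] := filter_ex (@filterT _ U _).
have M0 : 0 <= M by exact: le_trans (xM i).
have ex_l y : exists l : R, '[x n, y] @[n --> U] --> l.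
  have := @segment_compact R (- (M * `|y|)) (M * `|y|).
  rewrite compact_ultra => /(_ _ (ultra_fmap (fun n => '[x n, y]) UU)) [].
    suff : \forall n \near U, '[x n, y] \in `[(- (M * `|y|)), (M * `|y|)] by [].
    apply: nearW => n.
    rewrite in_itv/= -ler_norml; apply: le_trans (cauchy_schwarz _ _) _.
    by rewrite ler_wpM2r.
  by move=> l [_ ?]; exists l.
pose l y := projT1 (cid (ex_l y)).
have lP y : '[x n, y] @[n --> U] --> l y := projT2 (cid (ex_l y)).
have llin a y z : l (a *: y + z) = a * l y + l z.
  apply: (cvg_unique _ (lP (a *: y + z))) => //.
  have -> : (fun n => '[x n, a *: y + z]) = (fun n => a * '[x n, y] + '[x n, z]).
    by apply/funext => n; rewrite innerDr innerZr.
  by apply: cvgD => //; apply: cvgMr.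
have lM y : `|l y| <= M * `|y|.
  apply: (cvgr_to_le (cvg_norm (lP y))).
  by apply: nearW => n; apply: le_trans (cauchy_schwarz _ _) _; rewrite ler_wpM2r.
have [v vP] := riesz M0 llin lM.
exists v => y e e0.
apply: filterS (cvgr_dist_lt _ _ (lP y) _ e0) => n /=.
by rewrite vP innerBl distrC.
Qed.

End WeakLimits.

(** * Bessel and Garding inequalities *)

Section Garding.
Context {R : realType} {H : hilbertType R}.
Implicit Types x : nat -> H.

(** Choice of a sequence whose next term may depend on all the previous ones. *)
Lemma course_of_values_choice (T : Type) (P : seq T -> T -> Prop) :
  (forall s, exists z, P s z) -> exists x : nat -> T, forall n, P (mkseq x n) (x n).
Proof.
move=> exP; pose h s := projT1 (cid (exP s)).
pose S n := iter n (fun s => rcons s (h s)) [::].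
pose x n : T := h (S n).
have Sx n : S n = mkseq x n by elim: n => // n IH; rewrite /S iterS -/(S n) mkseqS -IH.
exists x => n; rewrite -Sx; exact: projT2 (cid (exP (S n))).
Qed.

Definition orthonormal n x :=
  forall i j, (i < n)%N -> (j < n)%N -> '[x i, x j] = (i == j)%:R.

Definition partial_proj n x z := \sum_(i < n) '[x i, z] *: x i.

Lemma partial_projS n x z :
  partial_proj n.+1 x z = partial_proj n x z + '[x n, z] *: x n.
Proof. exact: big_ord_recr. Qed.

Lemma inner_partial_proj n x z y :
  '[partial_proj n x z, y] = \sum_(i < n) '[x i, z] * '[x i, y].
Proof.
elim: n => [|n IH]; first by rewrite /partial_proj !big_ord0 inner0l.
by rewrite partial_projS innerDl IH innerZl big_ord_recr.
Qed.

Lemma inner_partial_proj_basis n x z j : orthonormal n x -> (j < n)%N ->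
  '[partial_proj n x z, x j] = '[x j, z].
Proof.
move=> ox jn; rewrite inner_partial_proj (bigD1 (Ordinal jn))//= ox// eqxx mulr1.
rewrite big1 ?addr0// => i ij; rewrite ox//.
have -> : (i == j :> nat) = false by apply: negbTE.
by rewrite mulr0.
Qed.

Lemma sqr_norm_partial_proj n x z : orthonormal n x ->
  `|partial_proj n x z| ^+ 2 = \sum_(i < n) '[x i, z] ^+ 2.
Proof.
move=> ox; rewrite -inner_norm inner_partial_proj; apply: eq_bigr => i _.
by rewrite (innerC _ (partial_proj _ _ _)) inner_partial_proj_basis.
Qed.

Lemma sqr_norm_proj_compl n x z : orthonormal n x ->
  `|z - partial_proj n x z| ^+ 2 = `|z| ^+ 2 - \sum_(i < n) '[x i, z] ^+ 2.
Proof.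
move=> ox; rewrite normB2 sqr_norm_partial_proj// innerC inner_partial_proj.
under eq_bigr do rewrite -expr2; lra.
Qed.

Lemma bessel n x z : orthonormal n x -> \sum_(i < n) '[x i, z] ^+ 2 <= `|z| ^+ 2.
Proof.
move=> ox; rewrite -subr_ge0 -(sqr_norm_proj_compl _ ox); exact: sqr_ge0.
Qed.

Lemma orthonormal_weakly_cvg0 x : (forall n, orthonormal n x) -> weakly_cvg x 0.
Proof.
move=> ox y; rewrite inner0l.
have sq0 : '[x n, y] ^+ 2 @[n --> \oo] --> (0 : R).
  (* The squares are the terms of a series bounded by Bessel's inequality. *)
  apply: cvg_series_cvg_0; apply: nondecreasing_is_cvgn.
    by apply: nondecreasing_series => n _ _; exact: sqr_ge0.
  exists (`|y| ^+ 2) => _ [n _ <-]; rewrite seriesEord; exact: bessel.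
apply/cvgr0Pnorm_lt => e e0.
apply: filterS (cvgr0_norm_lt _ sq0 _ (exprn_gt0 2 e0)) => n.
by rewrite normrX ltr_pXn2r// nnegrE// ltW.
Qed.

(** Coercivity up to finitely many directions, as in Garding's inequality.  The
    perturbation is a finite sum of squares, hence continuous under weak limits,
    and [d = 0] covers the positive semidefinite forms of the constraints. *)
Definition garding (A : H -> H) (d : R) :=
  exists (n : nat) (e : nat -> H) (C : R), 0 <= C /\
    forall z, d * `|z| ^+ 2 <= '[z, A z] + C * \sum_(i < n) '[e i, z] ^+ 2.

(** The lower limit is the supremum of the infima of the tails, so one tail
    has its infimum above [a]. *)
Lemma limn_einf_gt (u : nat -> R) (a b : R) : a < b ->
  (b%:E <= limn_einf (fun n => (u n)%:E))%E -> \forall n \near \oo, a < u n.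
Proof.
move=> ab; rewrite limn_einf_lim.
have -> : limn (einfs (fun n => (u n)%:E)) =
    ereal_sup (range (einfs (fun n => (u n)%:E))).
  by apply/cvg_lim => //; exact: cvg_einfs_sup.
move=> bu.
have /ereal_sup_gt[_ [N _ <-] aN] :
    (a%:E < ereal_sup (range (einfs (fun n => (u n)%:E))))%E.
  by apply: lt_le_trans bu; rewrite lte_fin.
exists N => // n /= Nn; rewrite -lte_fin; apply: lt_le_trans aN _.
by apply: ereal_inf_lbound; exists n.
Qed.

(** Otherwise every finite orthonormal family extends by a unit vector on which
    the form is as small as desired, and the resulting orthonormal sequence
    contradicts the Legendre property. *)
Lemma legendre_coercive_cofinite (A : {linear H -> H}) :
  legendre_form (fun z : H => '[z, A z]) ->
  exists n (x : nat -> H) (d : R), [/\ 0 < d, orthonormal n x &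
    forall z, (forall i, (i < n)%N -> '[x i, z] = 0) -> d * `|z| ^+ 2 <= '[z, A z]].
Proof.
move=> [Alsc Aleg]; apply: contrapT => noproj.
(* The conclusion is conditional on orthonormality of the list, so that every
   list has a successor; along the sequence it is then shown by induction. *)
pose P (s : seq H) (z : H) := orthonormal (size s) (nth 0 s) ->
  [/\ `|z| = 1, forall i, (i < size s)%N -> '[nth 0 s i, z] = 0 &
      '[z, A z] < (size s).+1%:R^-1].
have exP s : exists z, P s z.
  apply: contrapT => noz; apply: noproj.
  exists (size s), (nth 0 s), ((size s).+1%:R^-1).
  have os : orthonormal (size s) (nth 0 s).
    by apply: contrapT => nos; apply: noz; exists 0 => /nos.
  split=> // z zs; rewrite leNgt; apply/negP => Az; apply: noz.
  have z0 : 0 < `|z|.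
    rewrite normr_gt0; apply/eqP => z0.
    by move: Az; rewrite z0 inner0l normr0 expr0n mulr0 ltxx.
  exists (`|z|^-1 *: z) => _; split.
  - by rewrite normrZ ger0_norm ?invr_ge0// mulVf ?gt_eqF.
  - by move=> i si; rewrite innerZr zs ?mulr0.
  - rewrite linearZ innerZl innerZr mulrA mulrC -invfM -expr2.
    by rewrite ltr_pdivrMr ?exprn_gt0.
have [x xP] := course_of_values_choice exP.
have nthx n i : (i < n)%N -> nth 0 (mkseq x n) i = x i by move=> ?; rewrite nth_mkseq.
have ox n : orthonormal n x.
  elim: n => [|n IH] i j //; rewrite !ltnS => ni nj.
  have [|x1 xx _] := xP n.
    by move=> k l; rewrite size_mkseq => kn ln; rewrite !nthx//; exact: IH.
  have xi k : (k < n)%N -> '[x k, x n] = 0.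
    by move=> kn; have := xx k; rewrite size_mkseq nthx//; exact.
  move: ni nj; rewrite leq_eqVlt (leq_eqVlt j) => /predU1P[->|ni] /predU1P[->|nj].
  - by rewrite inner_norm x1 expr1n eqxx.
  - by rewrite innerC xi// gtn_eqF.
  - by rewrite xi// ltn_eqF.
  - exact: IH.
have {}xP n : `|x n| = 1 /\ '[x n, A (x n)] < n.+1%:R^-1.
  have [|x1 _] := xP n; last by rewrite size_mkseq.
  by move=> k l; rewrite size_mkseq => kn ln; rewrite !nthx//; exact: (ox n).
have wx := orthonormal_weakly_cvg0 ox.
have Ax0 : '[x n, A (x n)] @[n --> \oo] --> '[0 : H, A 0].
  rewrite inner0l; apply/cvgr0Pnorm_lt => e e0.
  have lsc := Alsc _ _ wx; rewrite inner0l in lsc.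
  have e0' : - e < 0 by rewrite oppr_lt0.
  near=> n; rewrite ltr_norml; apply/andP; split.
    by near: n; exact: limn_einf_gt lsc.
  apply: lt_trans (xP n).2 _.
  by near: n; exact: invS_small.
have /cvgr0_norm_lt x0 := Aleg _ _ wx Ax0.
have [N _ /(_ N (leqnn N))] := x0 _ (ltr01 : 0 < 1 :> R).
by rewrite /= (xP N).1 ltxx.
Unshelve. all: by end_near. Qed.

(** Split [z] into its projection [p] on the span of the finite family and the
    rest [q]; the cross term [2 <A q, p>] is absorbed by Young's inequality at
    the cost of half of the coercivity constant. *)
Lemma legendre_garding (A : {linear H -> H}) : continuous A -> self_adjoint A ->
  legendre_form (fun z : H => '[z, A z]) -> exists2 d, 0 < d & garding A d.
Proof.
move=> Acont Asa /legendre_coercive_cofinite[n [x [d [d0 ox Ad]]]].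
have [M M0 AM] := continuous_linear_bound Acont.
exists (d / 2); first by rewrite divr_gt0.
exists n, x, (2 * M ^+ 2 / d + M + d / 2); split.
  by rewrite !addr_ge0// ?divr_ge0 ?mulr_ge0 ?sqr_ge0// ltW.
move=> z; rewrite -(sqr_norm_partial_proj _ ox).
have := sqr_norm_proj_compl z ox; rewrite -(sqr_norm_partial_proj _ ox).
set p := partial_proj n x z; set q := z - p => zqp.
have Aq : d * `|q| ^+ 2 <= '[q, A q].
  apply: Ad => i ni; rewrite innerBr (innerC _ p).
  by rewrite inner_partial_proj_basis// subrr.
have -> : '[z, A z] = '[q, A q] + 2 * '[A q, p] + '[p, A p].
  have -> : z = q + p by rewrite subrK.
  rewrite linearD innerDl !innerDr (innerC p) -(Asa q p); ring.
have h1 : - (M * `|q| * `|p|) <= '[A q, p].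
  by apply: le_trans (inner_ge _ _); rewrite lerN2 ler_wpM2r.
have h2 : - (M * `|p| * `|p|) <= '[p, A p].
  by apply: le_trans (inner_ge _ _); rewrite lerN2 [leRHS]mulrC ler_wpM2l.
(* Young's inequality, from the square of [|q| - 2 M / d |p|]. *)
have h3 : 2 * (M * `|q| * `|p|) <= d / 2 * `|q| ^+ 2 + 2 * M ^+ 2 / d * `|p| ^+ 2.
  have : 0 <= d / 2 * (`|q| - 2 * M / d * `|p|) ^+ 2.
    by rewrite mulr_ge0 ?sqr_ge0// divr_ge0// ltW.
  have -> : d / 2 * (`|q| - 2 * M / d * `|p|) ^+ 2 =
    d / 2 * `|q| ^+ 2 + 2 * M ^+ 2 / d * `|p| ^+ 2 - 2 * (M * `|q| * `|p|).
    by field; rewrite gt_eqF.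
  lra.
have -> : `|z| ^+ 2 = `|q| ^+ 2 + `|p| ^+ 2 by rewrite zqp subrK.
move: h1 h2 h3 Aq; set c := 2 * M ^+ 2 / d; lra.
Qed.

Lemma psd_garding (A : H -> H) : pos_semidefinite A -> garding A 0.
Proof.
move=> Apsd; exists 0%N, (fun=> 0), 0; split=> // z.
by rewrite !mul0r addr0; exact: Apsd.
Qed.

Lemma garding_perturb (A B : H -> H) (d h : R) : garding A d ->
  (forall z, `|A z - B z| <= h * `|z|) -> garding B (d - h).
Proof.
move=> [n [e [C [C0 Ad]]]] AB; exists n, e, C; split=> // z.
have := Ad z; have := inner_le z (A z - B z); rewrite innerBr.
have := ler_wpM2l (normr_ge0 z) (AB z).
lra.
Qed.

(** Expanding around [v], the linear part of the difference and the squares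
    [<e_i, x n - v>^2] tend to [0], and what remains is at least
    [d / 2 * |x n - v|^2].  Keeping this term is what later turns weak
    convergence into strong convergence. *)
Lemma garding_weak_lsc (I : Type) (U : set_system I) (x : I -> H) v
    (A : {linear H -> H}) (c : H) (d e : R) {FU : Filter U} :
  self_adjoint A -> garding A d -> weak_lim U x v -> 0 < e ->
  \forall n \near U, 2^-1 * '[v, A v] + '[c, v] + d / 2 * `|x n - v| ^+ 2 <=
    2^-1 * '[x n, A (x n)] + '[c, x n] + e.
Proof.
move=> Asa [n [f [C [C0 Ad]]]] wx e0.
pose K := C * n%:R + 1.
have K0 : 0 < K by rewrite /K ltr_wpDl// mulr_ge0.
(* Each of the [n] squares will be at most [e / K], so [C] times their sum is
   at most [e]. *)
pose s := Num.sqrt (e / K).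
have s0 : 0 < s by rewrite sqrtr_gt0 divr_gt0.
have nearf : \forall k \near U, forall i : 'I_n, `|'[x k - v, f i]| < s.
  by apply: filter_forall => i; exact: wx.
near=> k.
have hf i : (i < n)%N -> '[f i, x k - v] ^+ 2 <= e / K.
  move=> ni; have : `|'[x k - v, f (Ordinal ni)]| < s by apply: (near nearf k).
  rewrite innerC /= => fi.
  rewrite -real_normK ?num_real// -(@sqr_sqrtr _ (e / K)) ?divr_ge0 ?ltW//.
  by rewrite ltr_pXn2r ?nnegrE ?(ltW s0) ?normr_ge0 ?fi.
have hS : C * \sum_(i < n) '[f i, x k - v] ^+ 2 <= e.
  have : \sum_(i < n) '[f i, x k - v] ^+ 2 <= \sum_(i < n) e / K.
    by apply: ler_sum => i _; exact: hf.
  rewrite sumr_const card_ord -mulr_natr => /(ler_wpM2l C0)/le_trans; apply.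
  have -> : C * (e / K * n%:R) = C * n%:R / K * e by ring.
  by rewrite -[leRHS]mul1r ler_wpM2r ?ltW// ltr_pdivrMr// mul1r /K ltrDl.
have hc : `|'[x k - v, A v + c]| < e / 2.
  by near: k; apply: wx; rewrite divr_gt0.
have -> : '[x k, A (x k)] = '[v, A v] + 2 * '[x k - v, A v] + '[x k - v, A (x k - v)].
  rewrite linearB !innerBl !innerBr -(Asa v (x k)) (innerC (A v)); ring.
have := Ad (x k - v); move: hc; rewrite ltr_norml innerDr => /andP[+ _].
rewrite (innerC _ c) (innerBr c); move: hS.
set S := C * _; lra.
Unshelve. all: by end_near. Qed.

End Garding.

(** * Quadratic functions and perturbation of the data *)

Section Estimates.
Context {R : realType} {H : hilbertType R}.
Implicit Types x y c : H.

Definition quad (A : H -> H) c x : R := 2^-1 * '[x, A x] + '[c, x].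

Lemma quad_perturb (A B : H -> H) (a b : H) (h : R) x :
  (forall z, `|A z - B z| <= h * `|z|) -> `|a - b| <= h ->
  `|quad A a x - quad B b x| <= h * (2^-1 * `|x| ^+ 2 + `|x|).
Proof.
move=> AB ab.
have -> : quad A a x - quad B b x = 2^-1 * '[x, A x - B x] + '[a - b, x].
  by rewrite /quad innerBr innerBl; ring.
apply: le_trans (ler_normD _ _) _; rewrite normrM (@ger0_norm _ 2^-1)// mulrDr.
apply: lerD.
  rewrite mulrCA ler_wpM2l//; apply: le_trans (cauchy_schwarz _ _) _.
  by rewrite expr2 mulrCA ler_wpM2l.
by apply: le_trans (cauchy_schwarz _ _) _; rewrite ler_wpM2r.
Qed.

Lemma quad_lipschitz (A : {linear H -> H}) c (B r : R) x y : self_adjoint A ->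
  (forall z, `|A z| <= B * `|z|) -> `|c| <= B -> `|x| <= r -> `|y| <= r ->
  `|quad A c x - quad A c y| <= B * (r + 1) * `|x - y|.
Proof.
move=> Asa AB cB xr yr; have B0 : 0 <= B by exact: le_trans cB.
have -> : quad A c x - quad A c y = '[x - y, 2^-1 *: A (x + y) + c].
  rewrite /quad innerDr innerZr (linearD A) innerDr !innerBl -(Asa y x).
  by rewrite (innerC c) (innerC c) (innerC (A y)); ring.
apply: le_trans (cauchy_schwarz _ _) _; rewrite mulrC ler_wpM2r//.
apply: le_trans (ler_normD _ _) _; rewrite normrZ (@ger0_norm _ 2^-1)//.
have := AB (x + y); have := ler_wpM2l B0 (ler_normD x y).
have := ler_wpM2l B0 xr; have := ler_wpM2l B0 yr; lra.
Qed.

Lemma quad_convex (A : {linear H -> H}) c x y (t : R) : self_adjoint A ->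
  pos_semidefinite A -> 0 <= t <= 1 ->
  quad A c (x + t *: (y - x)) <= (1 - t) * quad A c x + t * quad A c y.
Proof.
move=> Asa Apsd /andP[t0 t1].
have h : 0 <= 2^-1 * (t * (1 - t) * '[x - y, A (x - y)]).
  by rewrite !mulr_ge0// subr_ge0.
rewrite -subr_ge0; move: h; congr (_ <= _); rewrite /quad.
have -> : A (x + t *: (y - x)) = A x + t *: (A y - A x).
  by rewrite linearD linearZ/= linearB.
rewrite (linearB A) !innerDl !innerDr !innerZl !innerZr !innerBl.
rewrite !innerBr !innerNl !innerNr -(Asa x y) (innerC (A x)); ring.
Qed.

Lemma quad_bound (A : H -> H) c (B : R) x :
  (forall z, `|A z| <= B * `|z|) -> `|c| <= B ->
  `|quad A c x| <= B * (2^-1 * `|x| ^+ 2 + `|x|).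
Proof.
move=> AB cB; have := @quad_perturb A (fun=> 0) c 0 B x.
rewrite {2}/quad inner0r inner0l mulr0 addr0 !subr0; apply=> // z.
by rewrite subr0.
Qed.

End Estimates.

Section Data.
Context {R : realType} {H : hilbertType R} {m : nat}.
Implicit Types (w : Omega H m) (x : H).

Lemma objE x w : obj x w = quad (om_T w) (om_c w) x.
Proof. by []. Qed.

Lemma constrE i x w : constr i x w = quad (om_Ti w i) (om_ci w i) x + om_alpha w i.
Proof. by []. Qed.

Lemma opnorm_sub_ge (A B : {linear H -> H}) x : continuous A -> continuous B ->
  `|A x - B x| <= opnorm (fun z => A z - B z) * `|x|.
Proof.
move=> /continuous_linear_bound[a a0 Aa] /continuous_linear_bound[b b0 Bb].
apply: (@le_opnorm _ _ (fun z => A z - B z) (a + b)).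
  by move=> r y; rewrite scalerBr -(linearZZ A) -(linearZZ B).
move=> y; apply: le_trans (ler_normB _ _) _.
by rewrite mulrDl; apply: lerD; [exact: Aa|exact: Bb].
Qed.

Lemma om_dist_ge w w' : [/\ forall x, `|om_T w x - om_T w' x| <= om_dist w w' * `|x|,
  `|om_c w - om_c w'| <= om_dist w w',
  forall i x, `|om_Ti w i x - om_Ti w' i x| <= om_dist w w' * `|x|,
  forall i, `|om_ci w i - om_ci w' i| <= om_dist w w' &
  forall i, `|om_alpha w i - om_alpha w' i| <= om_dist w w'].
Proof.
pose F i := Num.max (opnorm (fun x => om_Ti w i x - om_Ti w' i x))
  (Num.max `|om_ci w i - om_ci w' i| `|om_alpha w i - om_alpha w' i|).
have Fi i : F i <= om_dist w w'.
  by rewrite /om_dist !le_max (le_bigmax_cond _ F (erefl : xpredT i)) ?orbT.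
split=> [x||i x|i|i].
- apply: le_trans (opnorm_sub_ge _ _ _) _; try exact: om_T_continuous.
  by rewrite ler_wpM2r// /om_dist le_max lexx.
- by rewrite /om_dist !le_max lexx orbT.
- apply: le_trans (opnorm_sub_ge _ _ _) _; try exact: om_Ti_continuous.
  by rewrite ler_wpM2r//; apply: le_trans (Fi i); rewrite le_max lexx.
- by apply: le_trans (Fi i); rewrite !le_max lexx orbT.
- by apply: le_trans (Fi i); rewrite !le_max lexx !orbT.
Qed.

Lemma om_dist_ge0 w w' : 0 <= om_dist w w'.
Proof. by have [_ h _ _ _] := om_dist_ge w w'; exact: le_trans h. Qed.

(** Differences enter [om_dist] only through norms. *)
Lemma om_distC w w' : om_dist w w' = om_dist w' w.
Proof.
rewrite /om_dist opnorm_subC distrC; congr (Num.max _ (Num.max _ _)).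
by apply: eq_bigr => i _; rewrite opnorm_subC !(distrC (om_ci w i))
  !(distrC (om_alpha w i)).
Qed.

Lemma om_dist_le w w' (h : R) : 0 <= h ->
  (forall x, `|om_T w x - om_T w' x| <= h * `|x|) -> `|om_c w - om_c w'| <= h ->
  (forall i x, `|om_Ti w i x - om_Ti w' i x| <= h * `|x|) ->
  (forall i, `|om_ci w i - om_ci w' i| <= h) ->
  (forall i, `|om_alpha w i - om_alpha w' i| <= h) -> om_dist w w' <= h.
Proof.
move=> h0 hT hc hTi hci ha; rewrite /om_dist !ge_max opnorm_le//= hc/=.
by apply: bigmax_le => // i _; rewrite !ge_max opnorm_le//= hci ha.
Qed.

Lemma om_dist_refl w : om_dist w w = 0.
Proof.
apply/le_anti; rewrite om_dist_ge0 andbT.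
by apply: om_dist_le => //= *; rewrite subrr normr0 ?mul0r.
Qed.

Lemma obj_perturb x w w' :
  `|obj x w - obj x w'| <= om_dist w w' * (1 + `|x|) ^+ 2.
Proof.
have [hT hc _ _ _] := om_dist_ge w w'.
apply: le_trans (quad_perturb x hT hc) _; rewrite ler_wpM2l ?om_dist_ge0//.
have := normr_ge0 x; have := sqr_ge0 `|x|; lra.
Qed.

Lemma constr_perturb i x w w' :
  `|constr i x w - constr i x w'| <= om_dist w w' * (1 + `|x|) ^+ 2.
Proof.
have [_ _ /(_ i) hT /(_ i) hc /(_ i) ha] := om_dist_ge w w'.
rewrite !constrE opprD addrACA; apply: le_trans (ler_normD _ _) _.
apply: le_trans (lerD (quad_perturb x hT hc) ha) _.
have : om_dist w w' * (2^-1 * `|x| ^+ 2 + `|x| + 1) <= om_dist w w' * (1 + `|x|) ^+ 2.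
  rewrite ler_wpM2l ?om_dist_ge0//.
  have := normr_ge0 x; have := sqr_ge0 `|x|; lra.
lra.
Qed.

Lemma om_bound w : exists B, [/\ 0 <= B,
  (forall x, `|om_T w x| <= B * `|x|) /\ `|om_c w| <= B,
  forall i x, `|om_Ti w i x| <= B * `|x|, forall i, `|om_ci w i| <= B &
  forall i, `|om_alpha w i| <= B].
Proof.
have [b b0 Tb] := continuous_linear_bound (@om_T_continuous _ _ _ w).
have ex i : exists c, 0 <= c /\ forall x, `|om_Ti w i x| <= c * `|x|.
  by have [c c0 Tc] := continuous_linear_bound (@om_Ti_continuous _ _ _ w i); exists c.
pose c i := projT1 (cid (ex i)).
have c0 i : 0 <= c i := (projT2 (cid (ex i))).1.
have cT i x : `|om_Ti w i x| <= c i * `|x| := (projT2 (cid (ex i))).2 x.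
pose F i := c i + `|om_ci w i| + `|om_alpha w i|.
have F0 i : 0 <= F i by rewrite !addr_ge0.
have FS i : F i <= \sum_j F j by rewrite (bigD1 i)//= lerDl sumr_ge0.
pose B := b + `|om_c w| + \sum_j F j.
have S0 : 0 <= \sum_j F j by rewrite sumr_ge0.
have FB i : F i <= B by rewrite (le_trans (FS i))// lerDr addr_ge0.
exists B; split.
- by rewrite !addr_ge0.
- split=> [x|]; last by rewrite /B -addrA addrCA lerDl addr_ge0.
  by apply: le_trans (Tb x) _; rewrite ler_wpM2r// /B -addrA lerDl addr_ge0.
- move=> i x; apply: le_trans (cT i x) _; rewrite ler_wpM2r//.
  by apply: le_trans (FB i); rewrite /F -addrA lerDl addr_ge0.
- by move=> i; apply: le_trans (FB i); rewrite /F -addrA addrCA lerDl addr_ge0.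
- by move=> i; apply: le_trans (FB i); rewrite /F lerDr addr_ge0.
Qed.

Lemma SolP w x : Sol w x <->
  feasible w x /\ forall y, feasible w y -> obj x w <= obj y w.
Proof.
split=> -[wx xw]; split=> //.
  by move=> y wy; rewrite -lee_fin xw; apply: ereal_inf_lbound; exists y.
apply/le_anti/andP; split.
  by apply/ereal_infP => _ [y wy <-]; rewrite lee_fin xw.
by apply: ereal_inf_lbound; exists x.
Qed.

End Data.

(** * Coercivity at infinity and existence of solutions *)

Section Stability.
Context {R : realType} {H : hilbertType R} {m : nat}.
Implicit Types (w : Omega H m) (x v : H).

(** The first two conditions say that [v] is in the recession cone of the
    feasible set (when that set is nonempty). *)
Definition recession_positive w := forall v,
  (forall i, om_Ti w i v = 0) -> (forall i, '[om_ci w i, v] <= 0) ->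
  '[v, om_T w v] <= 0 -> v = 0.

Definition slater w := exists x s, 0 < s /\ forall i, constr i x w <= - s.

(** A penalty which vanishes exactly on the recession cone.  It is homogeneous
    of degree 2, like the quadratic form to which it is added. *)
Definition recession_gap w x : R :=
  \sum_(i < m) ('[x, om_Ti w i x] + Num.max '[om_ci w i, x] 0 ^+ 2).

Lemma recession_gap_term w i x :
  0 <= '[x, om_Ti w i x] + Num.max '[om_ci w i, x] 0 ^+ 2 <= recession_gap w x.
Proof.
have pos j : 0 <= '[x, om_Ti w j x] + Num.max '[om_ci w j, x] 0 ^+ 2.
  by rewrite addr_ge0 ?sqr_ge0//; exact: om_Ti_psd.
by rewrite pos/= /recession_gap (bigD1 i)//= lerDl sumr_ge0.
Qed.

Lemma recession_gap_ge0 w x : 0 <= recession_gap w x.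
Proof. by apply: sumr_ge0 => i _; have /andP[] := recession_gap_term w i x. Qed.

Lemma recession_gapZ w (a : R) x : 0 <= a ->
  recession_gap w (a *: x) = a ^+ 2 * recession_gap w x.
Proof.
move=> a0; rewrite /recession_gap mulr_sumr; apply: eq_bigr => i _.
rewrite linearZZ innerZl !innerZr mulrDr mulrA -expr2; congr (_ + _).
by rewrite -[in LHS](mulr0 a) -maxr_pMr// exprMn.
Qed.

Lemma exists_ultra_oo : exists U : set_system nat, UltraFilter U /\ \oo `<=` U.
Proof. exact: ultraFilterLemma. Qed.

(** Penalty method.  If no multiple [N] of the gap suffices, there are unit
    vectors [u n] with [<u n, T (u n)> + n gap < 1/(n+1)].  Their weak limit [v]
    has zero gap and [<v, T v> <= 0], so [v = 0] by assumption; but then the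
    defect term [d |u n - v|^2 = d] would have to be arbitrarily small. *)
Lemma recession_coercive w d : garding (om_T w) d -> 0 < d -> recession_positive w ->
  exists k N, [/\ 0 < k, 0 <= N &
    forall x, k * `|x| ^+ 2 <= '[x, om_T w x] + N * recession_gap w x].
Proof.
move=> gT d0 wK; apply: contrapT => noc.
have ex_u n : exists u, `|u| = 1 /\
    '[u, om_T w u] + n%:R * recession_gap w u < n.+1%:R^-1.
  apply: contrapT => nou; apply: noc.
  exists (n.+1%:R^-1), n%:R; split=> // x.
  have [->|x0] := eqVneq x 0.
    rewrite normr0 expr0n mulr0 inner0l add0r mulr_ge0//.
    exact: recession_gap_ge0.
  have nx : 0 < `|x| by rewrite normr_gt0.
  rewrite leNgt; apply/negP => xlt; apply: nou.
  exists (`|x|^-1 *: x); split.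
    by rewrite normrZ ger0_norm ?invr_ge0// mulVf ?gt_eqF.
  rewrite recession_gapZ ?invr_ge0// linearZZ innerZl innerZr mulrA -expr2.
  rewrite mulrCA -mulrDr exprVn mulrC ltr_pdivrMr ?exprn_gt0//.
pose u n := projT1 (cid (ex_u n)).
have [u1 uP] : (forall n, `|u n| = 1) /\
    forall n, '[u n, om_T w (u n)] + n%:R * recession_gap w (u n) < n.+1%:R^-1.
  by split=> n; have [] := projT2 (cid (ex_u n)).
have [B [B0 [TB _] _ _ _]] := om_bound w.
have [U [UU ooU]] := exists_ultra_oo.
have FU : Filter U by apply: filter_filter.
have [v uv] : exists v, weak_lim U u v.
  by apply: (@ultra_weak_lim _ _ _ U u 1) => n; rewrite u1.
have gap0 e : 0 < e -> \forall n \near U, recession_gap w (u n) < e.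
  move=> e0; near=> n; rewrite ltNge; apply/negP => en.
  have nB : (1 + B) / e < n%:R by near: n; apply: ooU; exact: nbhs_infty_gtr.
  have n1 : n.+1%:R^-1 <= 1 :> R by rewrite invf_le1// ler1n.
  have := inner_ge (u n) (om_T w (u n)); have := TB (u n).
  rewrite u1 mul1r mulr1 => uB uT.
  have := lt_le_trans (uP n) n1; have := ler_wpM2l (ler0n R n) en.
  by move: nB; rewrite ltr_pdivrMr//; lra.
have vTi i : om_Ti w i v = 0.
  apply: psd_form_eq0; [exact: om_Ti_self_adjoint|exact: om_Ti_psd|].
  apply/ler_addgt0Pl => e e0; have e4 : 0 < e / 4 by rewrite divr_gt0.
  have lsc := garding_weak_lsc (FU := FU) 0 (om_Ti_self_adjoint w i)
    (psd_garding (@om_Ti_psd _ _ _ w i)) uv e4.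
  have [n [/=]] := filter_ex (filterI lsc (gap0 _ e4)).
  have /andP[_] := recession_gap_term w i (u n).
  rewrite !inner0l mul0r mul0r; have := sqr_ge0 (Num.max '[om_ci w i, u n] 0); lra.
have vci i : '[om_ci w i, v] <= 0.
  apply/ler_addgt0Pl => e e0; have e2 : 0 < e / 2 by rewrite divr_gt0.
  have [n [/=]] := filter_ex (filterI (gap0 _ (exprn_gt0 2 e2)) (uv (om_ci w i) _ e2)).
  have /andP[_ gi] := recession_gap_term w i (u n).
  rewrite innerBl ltr_norml => Se /andP[h _].
  have : Num.max '[om_ci w i, u n] 0 < e / 2.
    rewrite -(@ltr_pXn2r _ 2)// ?nnegrE ?le_max ?lexx ?orbT ?(ltW e2)//.
    by apply: le_lt_trans Se; apply: le_trans gi; rewrite lerDr; exact: om_Ti_psd.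
  rewrite gt_max => /andP[hu _]; move: h hu; rewrite !(innerC (om_ci w i)); lra.
have lscT e : 0 < e -> \forall n \near U,
    '[v, om_T w v] + d * `|u n - v| ^+ 2 <= e.
  move=> e0; have e4 : 0 < e / 4 by rewrite divr_gt0.
  have lsc := garding_weak_lsc (FU := FU) 0 (om_T_self_adjoint w) gT uv e4.
  near=> n; have n1 : n.+1%:R^-1 < e / 4 by near: n; apply: ooU; exact: invS_small.
  have := uP n; have := mulr_ge0 (ler0n R n) (recession_gap_ge0 w (u n)).
  have : 2^-1 * '[v, om_T w v] + '[0, v] + d / 2 * `|u n - v| ^+ 2 <=
    2^-1 * '[u n, om_T w (u n)] + '[0, u n] + e / 4 by near: n.
  rewrite !inner0l; move: n1; set a := n.+1%:R^-1; lra.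
have v0 : v = 0.
  apply: wK => //; apply/ler_addgt0Pl => e e0.
  have [n] := filter_ex (lscT e e0).
  have := mulr_ge0 (ltW d0) (sqr_ge0 `|u n - v|); lra.
have [n] := filter_ex (lscT (d / 2) (divr_gt0 d0 (ltr0Sn R 1))).
rewrite v0 inner0l subr0 u1; lra.
Unshelve. all: by end_near. Qed.


(** For [x] feasible for nearby data and of bounded objective, both [<x, T x>]
    and the gap of [x] at [w] are at most [h |x|^2] up to affine terms in [|x|],
    where [h] is the distance between the data; for small [h] the coercive
    inequality absorbs [h |x|^2]. *)
Lemma sublevel_bounded w l d : garding (om_T w) d -> 0 < d -> recession_positive w ->
  exists e M, [/\ 0 < e, 0 <= M & forall w' x, om_dist w' w < e ->
    feasible w' x -> obj x w' <= l -> `|x| <= M].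
Proof.
move=> gT d0 wK; have [k [N [k0 N0 kN]]] := recession_coercive gT d0 wK.
have [B [B0 [TB cB] TiB ciB aB]] := om_bound w.
(* The final estimate is [k r^2 <= W1 h r^2 + W2 r + W3] with [r = |x|], and
   [h <= k / (2 W1)] absorbs the quadratic term. *)
pose W1 := 4 + 6 * (N * m%:R).
pose W2 := 2 * B + 2 * (N * m%:R) * B.
pose W3 := 2 * `|l| + 4 + N * m%:R * (4 + 2 * B + 2 * (B + 1) ^+ 2).
have Nm0 : 0 <= N * m%:R by rewrite mulr_ge0.
have W10 : 0 < W1 by rewrite /W1 ltr_wpDr// mulr_ge0.
have W20 : 0 <= W2 by rewrite /W2 addr_ge0// !mulr_ge0.
have W30 : 0 <= W3.
  have := mulr_ge0 Nm0 B0; have := mulr_ge0 Nm0 (sqr_ge0 (B + 1)).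
  by have := normr_ge0 l; rewrite /W3; lra.
have t0 : 0 <= 2 * (W2 + W3) / k.
  by apply: divr_ge0 (ltW k0); apply: mulr_ge0 => //; exact: addr_ge0.
exists (Num.min 1 (k / (2 * W1))), (1 + 2 * (W2 + W3) / k); split.
- by rewrite lt_min ltr01 divr_gt0// mulr_gt0.
- by rewrite addr_ge0.
move=> w' x; rewrite lt_min => /andP[/ltW e1 /ltW ek] w'x xl.
set h := om_dist w' w in e1 ek; have h0 : 0 <= h := om_dist_ge0 w' w.
set r := `|x|; have r0 : 0 <= r := normr_ge0 x.
have [_ _ _ hci ha] := om_dist_ge w w'; rewrite (om_distC w) -/h in hci ha.
have objx : '[x, om_T w x] <= 2 * (`|l| + h * (1 + r) ^+ 2 + B * r).
  have := obj_perturb x w' w; rewrite ler_norml => /andP[+ _].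
  have := ler_norm l.
  have := inner_ge (om_c w) x; have := ler_wpM2r r0 cB.
  rewrite -/h -/r [obj x w]/obj; lra.
(* The quadratic part of the constraint of [w'] is nonnegative, so the linear
   part is bounded by the constant one. *)
have cx i : '[om_ci w i, x] <= h * r + B + 1.
  have := om_Ti_psd w' i x; have := w'x i; rewrite /constr.
  have := ler_norm (- om_alpha w' i); rewrite normrN.
  have := ler_normB (om_alpha w i) (om_alpha w i - om_alpha w' i).
  rewrite subKr; have := aB i; have := ha i.
  have := inner_le (om_ci w i - om_ci w' i) x; rewrite innerBl.
  have := ler_wpM2r r0 (hci i); rewrite -/h -/r; lra.
have Tx i : '[x, om_Ti w i x] <= 2 * (h * (1 + r) ^+ 2 + B * r + B).
  have := constr_perturb i x w' w; rewrite ler_norml => /andP[+ _].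
  have := w'x i; have := ler_norm (- om_alpha w i); rewrite normrN.
  have := aB i; have := inner_ge (om_ci w i) x; have := ler_wpM2r r0 (ciB i).
  rewrite -/h -/r [constr i x w]/constr; lra.
have sq1 : (1 + r) ^+ 2 <= 2 + 2 * r ^+ 2 by have := sqr_ge0 (r - 1); lra.
have hsq1 : h * (1 + r) ^+ 2 <= 2 + 2 * (h * r ^+ 2).
  have := ler_wpM2l h0 sq1; lra.
have hh : h ^+ 2 * r ^+ 2 <= h * r ^+ 2.
  by rewrite expr2 -mulrA ler_piMl// mulr_ge0// sqr_ge0.
have gapx : recession_gap w x <=
    m%:R * (2 * (2 + 2 * (h * r ^+ 2) + B * r + B) + 2 * (h * r ^+ 2) +
            2 * (B + 1) ^+ 2).
  rewrite /recession_gap; set K := (X in _ * X).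
  have -> : m%:R * K = \sum_(i < m) K by rewrite sumr_const card_ord mulr_natl.
  apply: ler_sum => i _; rewrite /K.
  have b0 : 0 <= h * r + B + 1 by rewrite !addr_ge0// mulr_ge0.
  have : Num.max '[om_ci w i, x] 0 ^+ 2 <= (h * r + B + 1) ^+ 2.
    by rewrite ler_pXn2r ?nnegrE ?le_max ?lexx ?orbT// ge_max cx b0.
  have := sqr_ge0 (h * r - (B + 1)); have := Tx i.
  have -> : (h * r + B + 1) ^+ 2 =
    h ^+ 2 * r ^+ 2 + 2 * (h * r * (B + 1)) + (B + 1) ^+ 2 by ring.
  have -> : (h * r - (B + 1)) ^+ 2 =
    h ^+ 2 * r ^+ 2 - 2 * (h * r * (B + 1)) + (B + 1) ^+ 2 by ring.
  move: hh hsq1; set p := h * r ^+ 2; set q := h ^+ 2 * _; set t := (B + 1) ^+ 2.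
  set y := h * r * _; set z := h * _ ^+ 2; lra.
have main : k * r ^+ 2 <= W1 * h * r ^+ 2 + W2 * r + W3.
  apply: le_trans (kN x) _; have := ler_wpM2l N0 gapx.
  move: objx hsq1; rewrite /W1 /W2 /W3; set z := h * (1 + r) ^+ 2; lra.
have Wh : W1 * h <= k / 2.
  by move: ek; rewrite ler_pdivlMr ?mulr_gt0//; lra.
have {}main : k * r ^+ 2 <= 2 * (W2 * r + W3).
  have := ler_wpM2r (sqr_ge0 r) Wh; lra.
rewrite leNgt; apply/negP => rM.
have r1 : 1 <= r by lra.
have W3r : W3 <= W3 * r by rewrite ler_peMr.
have : k * r <= 2 * (W2 + W3).
  by rewrite -(@ler_pM2r _ r) ?(lt_le_trans ltr01)//; move: main; rewrite expr2; lra.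
rewrite mulrC -ler_pdivlMr//; lra.
Qed.

(** The direct method, with approximate constraints and values so that it
    serves both for minimising sequences of one problem and for solutions of a
    sequence of approaching problems. *)
Lemma weak_limit_of_approx_solutions (I : Type) (U : set_system I) (y : I -> H)
    (M b d : R) w :
  UltraFilter U -> garding (om_T w) d -> (forall n, `|y n| <= M) ->
  (forall e, 0 < e -> \forall n \near U,
    (forall i, constr i (y n) w <= e) /\ obj (y n) w <= b + e) ->
  exists v, feasible w v /\
    forall e, 0 < e -> \forall n \near U, obj v w + d / 2 * `|y n - v| ^+ 2 <= b + e.
Proof.
move=> UU gT yM approx; have [v yv] := ultra_weak_lim UU yM.
have FU : Filter U by apply: filter_filter.
exists v; split=> [i|e e0].
  apply/ler_addgt0Pl => e e0; rewrite addr0.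
  have e2 : 0 < e / 2 by rewrite divr_gt0.
  have lsc := garding_weak_lsc (FU := FU) (om_ci w i) (om_Ti_self_adjoint w i)
    (psd_garding (@om_Ti_psd _ _ _ w i)) yv e2.
  have [n [/= ln [/(_ i) + _]]] := filter_ex (filterI lsc (approx _ e2)).
  by move: ln; rewrite /constr mul0r mul0r; lra.
have e2 : 0 < e / 2 by rewrite divr_gt0.
have lsc := garding_weak_lsc (FU := FU) (om_c w) (om_T_self_adjoint w) gT yv e2.
apply: filterS (filterI lsc (approx _ e2)) => n [/= ln [_ +]].
by move: ln; rewrite /obj; lra.
Qed.

Lemma Sol_nonempty w x0 M d : garding (om_T w) d -> 0 <= d -> feasible w x0 ->
  (forall x, feasible w x -> obj x w <= obj x0 w -> `|x| <= M) -> Sol w !=set0.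
Proof.
move=> gT d0 wx0 bdd.
pose E := [set obj x w | x in [set x | feasible w x /\ obj x w <= obj x0 w]].
have [B [B0 [TB cB] _ _ _]] := om_bound w.
have hE : has_inf E.
  split; first by exists (obj x0 w), x0.
  exists (- (B * (2^-1 * M ^+ 2 + M))) => _ [x [wx xx0] <-].
  have xM := bdd x wx xx0; have M0 : 0 <= M := le_trans (normr_ge0 x) xM.
  have := quad_bound x TB cB; rewrite -objE ler_norml => /andP[+ _].
  apply: le_trans; rewrite lerN2 ler_wpM2l// lerD// ler_wpM2l//.
  by rewrite ler_pXn2r// nnegrE.
have ex_y n : exists y, [/\ feasible w y, obj y w <= obj x0 w &
    obj y w < inf E + n.+1%:R^-1].
  have n0 : 0 < n.+1%:R^-1 :> R by rewrite invr_gt0.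
  by have [_ [y [wy yx0] <-] yE] := inf_adherent n0 hE; exists y.
pose y n := projT1 (cid (ex_y n)).
have yP n : [/\ feasible w (y n), obj (y n) w <= obj x0 w &
    obj (y n) w < inf E + n.+1%:R^-1] := projT2 (cid (ex_y n)).
have [U [UU ooU]] := exists_ultra_oo.
have yM n : `|y n| <= M by have [? ? _] := yP n; exact: bdd.
have [e e0|v [wv vE]] := weak_limit_of_approx_solutions (b := inf E) UU gT yM.
  near=> n; have [wy _ yE] := yP n; split=> [i|].
    by apply: le_trans (ltW e0); exact: wy.
  apply: ltW; apply: lt_trans yE _; rewrite ltrD2l.
  by near: n; apply: ooU; exact: invS_small.
exists v; apply/SolP; split=> // z wz.
have vE' : obj v w <= inf E.
  apply/ler_addgt0Pr => e e0; have [n] := filter_ex (vE e e0).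
  have := mulr_ge0 (divr_ge0 d0 (ler0n R 2)) (sqr_ge0 `|y n - v|); lra.
apply: le_trans vE' _; have [zx0|/ltW x0z] := leP (obj z w) (obj x0 w).
  by apply: ge_inf; [case: hE|exists z].
by apply: le_trans x0z; apply: ge_inf; [case: hE|exists x0].
Unshelve. all: by end_near. Qed.

End Stability.

(** * Stability of regular data *)

Section Consequences.
Context {R : realType} {H : hilbertType R} {m : nat}.
Implicit Types (w : Omega H m) (x v : H).

Lemma optval_Sol w x : Sol w x -> optval w = (obj x w)%:E.
Proof. by move=> []. Qed.

(** Convexity: with violation at most [h] at [y] and margin [s] at [x], the
    weight [t = h / (h + s)] solves [(1 - t) h - t s = 0]. *)
Lemma slater_repair w x y (s h : R) : 0 < s -> 0 <= h ->
  (forall i, constr i x w <= - s) -> (forall i, constr i y w <= h) ->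
  feasible w (y + (h / (h + s)) *: (x - y)).
Proof.
move=> s0 h0 xs yh i; have hs : 0 < h + s by rewrite ltr_wpDl.
have t01 : 0 <= h / (h + s) <= 1.
  by rewrite divr_ge0 ?(ltW hs)//= ler_pdivrMr// mul1r lerDl ltW.
have := quad_convex (om_ci w i) y x (om_Ti_self_adjoint w i) (om_Ti_psd w i) t01.
rewrite constrE => cvx.
have -> : 0 = (1 - h / (h + s)) * h + h / (h + s) * (- s) by field; rewrite gt_eqF.
move: t01 => /andP[t0 t1].
have := ler_wpM2l t0 (xs i).
have t1' : 0 <= 1 - h / (h + s) by rewrite subr_ge0.
have := ler_wpM2l t1' (yh i); rewrite !constrE; move: cvx.
set t := h / (h + s); lra.
Qed.

(** All the uniform estimates near regular data: solvability, a common bound,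
    and a one-sided Lipschitz estimate of the value.  For the last one, a
    solution for [w2] violates the constraints of [w1] by at most a multiple of
    the distance, and is repaired by moving proportionally towards the Slater
    point. *)
Lemma regular_stable w d : garding (om_T w) d -> 0 < d ->
  recession_positive w -> slater w ->
  exists e M L, [/\ 0 < e /\ 0 <= L,
    forall w', om_dist w' w < e -> Sol w' !=set0,
    forall w' x, om_dist w' w < e -> Sol w' x -> `|x| <= M &
    forall w1 w2 x1 x2, om_dist w1 w < e -> om_dist w2 w < e ->
      Sol w1 x1 -> Sol w2 x2 -> obj x1 w1 <= obj x2 w2 + L * om_dist w1 w2].
Proof.
move=> gT d0 wK [xs [s [s0 xsP]]].
pose q := (1 + `|xs|) ^+ 2; have q0 : 0 < q by rewrite exprn_gt0// ltr_wpDr.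
have [e1 [M [e10 M0 eM]]] := sublevel_bounded (obj xs w + q) gT d0 wK.
have [B [B0 [TB cB] _ _ _]] := om_bound w.
(* In this ball sublevel sets are bounded, the Garding constant is at least
   [d / 2] and the Slater margin at least [s / 2]. *)
pose e := Num.min e1 (Num.min 1 (Num.min (d / 2) (s / 2 / q))).
have e0 : 0 < e by rewrite !lt_min e10 ltr01 !divr_gt0.
have inE w' : om_dist w' w < e -> [/\ om_dist w' w < e1, om_dist w' w <= 1,
    om_dist w' w <= d / 2 & om_dist w' w * q <= s / 2].
  rewrite !lt_min => /and4P[-> /ltW -> /ltW ->]; rewrite ltr_pdivlMr// => /ltW.
  by split.
have xs2 w' i : om_dist w' w < e -> constr i xs w' <= - (s / 2).
  move=> /inE[_ _ _ h]; have := constr_perturb i xs w' w; rewrite ler_norml => /andP[_].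
  by rewrite -/q; have := xsP i; lra.
have xsF w' : om_dist w' w < e -> feasible w' xs.
  by move=> w'e i; apply: le_trans (xs2 _ _ w'e) _; rewrite oppr_le0 divr_ge0// ltW.
have xsl w' : om_dist w' w < e -> obj xs w' <= obj xs w + q.
  move=> /inE[_ h1 _ _]; have := obj_perturb xs w' w; rewrite ler_norml => /andP[_].
  by have := ler_wpM2r (ltW q0) h1; rewrite -/q; lra.
have SolM w' x : om_dist w' w < e -> Sol w' x -> `|x| <= M.
  move=> w'e /SolP[wx xopt]; have [he1 _ _ _] := inE _ w'e.
  by apply: eM he1 wx _; apply: le_trans (xsl _ w'e); exact/xopt/xsF.
pose r := M + `|xs|; have r0 : 0 <= r by rewrite addr_ge0.
(* First term: change of the objective at a fixed point of norm at most [M].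
   Second term: Lipschitz constant of the objective on the ball of radius [r]
   times the length of the repairing step. *)
pose L := (1 + M) ^+ 2 + (B + 1) * (r + 1) * (2 * (1 + M) ^+ 2 / s * (2 * r)).
exists e, M, L; split=> //.
- split=> //; rewrite /L addr_ge0 ?sqr_ge0// !mulr_ge0 ?addr_ge0 ?invr_ge0 ?sqr_ge0//.
  exact: ltW.
- move=> w' w'e; have [he1 _ hd _] := inE _ w'e.
  apply: (Sol_nonempty (x0 := xs) (M := M) (d := d - om_dist w' w)).
  + apply: garding_perturb gT _ => z.
    by rewrite om_distC; have [hT _ _ _ _] := om_dist_ge w w'.
  + by rewrite subr_ge0; apply: le_trans hd _;
       rewrite ler_pdivrMr// ler_peMr ?ltW// ltr1n.
  + exact: xsF.
  + by move=> x wx xx; apply: eM he1 wx _; exact: le_trans xx (xsl _ w'e).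
move=> w1 w2 x1 x2 w1e w2e Sx1 Sx2.
have x2M := SolM _ _ w2e Sx2.
pose h := om_dist w1 w2 * (1 + M) ^+ 2.
have h0 : 0 <= h by rewrite mulr_ge0 ?om_dist_ge0 ?sqr_ge0.
have hx2 : om_dist w1 w2 * (1 + `|x2|) ^+ 2 <= h.
  by rewrite ler_wpM2l ?om_dist_ge0// ler_pXn2r ?nnegrE ?addr_ge0// lerD2l.
have hE : h = om_dist w1 w2 * (1 + M) ^+ 2 by [].
clearbody h.
have cx2 i : constr i x2 w1 <= h.
  have := constr_perturb i x2 w1 w2; rewrite ler_norml => /andP[_].
  by have /SolP[/(_ i) + _] := Sx2; lra.
have s20 : 0 < s / 2 by rewrite divr_gt0.
pose t := h / (h + s / 2).
have t0 : 0 <= t by rewrite divr_ge0// addr_ge0// ltW.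
have t1 : t <= 1 by rewrite ler_pdivrMr ?ltr_wpDl// mul1r lerDl ltW.
have ts : t <= 2 * h / s.
  rewrite /t ler_pdivrMr ?ltr_wpDl//.
  have -> : 2 * h / s * (h + s / 2) = h + 2 * h * h / s by field; rewrite gt_eqF.
  by rewrite lerDl; rewrite divr_ge0 ?(ltW s0)// !mulr_ge0.
have zF : feasible w1 (x2 + t *: (xs - x2)).
  exact: slater_repair s20 h0 (fun i => xs2 w1 i w1e) cx2.
clearbody t; set z := x2 + t *: (xs - x2) in zF.
have /SolP[_ /(_ _ zF) x1z] := Sx1.
have x2r : `|x2| <= r by apply: le_trans x2M _; rewrite lerDl.
have nz : `|z - x2| <= t * (2 * r).
  rewrite /z addrAC subrr add0r normrZ (ger0_norm t0) ler_wpM2l//.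
  apply: le_trans (ler_normB _ _) _; rewrite /r.
  by have := normr_ge0 xs; lra.
have zr : `|z| <= r.
  have -> : z = (1 - t) *: x2 + t *: xs.
    by rewrite /z scalerBr scalerBl scale1r addrAC addrA addrAC.
  apply: le_trans (ler_normD _ _) _; rewrite !normrZ (ger0_norm t0).
  rewrite ger0_norm ?subr_ge0//.
  have t1' : 0 <= 1 - t by rewrite subr_ge0.
  have := ler_wpM2l t1' x2M; have := ler_piMl (normr_ge0 xs) t1.
  have := ler_piMl M0 (_ : 1 - t <= 1); rewrite /r; lra.
have [_ w11 _ _] := inE _ w1e.
have [hT hc _ _ _] := om_dist_ge w1 w.
have T1B y : `|om_T w1 y| <= (B + 1) * `|y|.
  rewrite -(subrK (om_T w y) (om_T w1 y)); apply: le_trans (ler_normD _ _) _.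
  have := hT y; have := TB y; have := ler_wpM2r (normr_ge0 y) w11; lra.
have c1B : `|om_c w1| <= B + 1.
  rewrite -(subrK (om_c w) (om_c w1)); apply: le_trans (ler_normD _ _) _; lra.
have := quad_lipschitz (om_T_self_adjoint w1) T1B c1B zr x2r.
rewrite -!objE ler_norml => /andP[_ zx2].
have := obj_perturb x2 w1 w2; rewrite ler_norml => /andP[_ x2w].
have K0 : 0 <= (B + 1) * (r + 1) by rewrite mulr_ge0// addr_ge0.
have r20 : 0 <= 2 * r by rewrite mulr_ge0.
have := ler_wpM2l K0 (le_trans nz (ler_wpM2r r20 ts)).
have -> : (B + 1) * (r + 1) * (2 * h / s * (2 * r)) =
  (L - (1 + M) ^+ 2) * om_dist w1 w2.
  by rewrite /L hE; field; rewrite gt_eqF.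
rewrite mulrBl [(1 + M) ^+ 2 * _]mulrC -hE; lra.
Qed.

Lemma regular_lipschitz w d : garding (om_T w) d -> 0 < d ->
  recession_positive w -> slater w -> optval_lipschitz_around w.
Proof.
move=> gT d0 wK wS.
have [e [M [L [[e0 L0] Sol0 _ SolL]]]] := regular_stable gT d0 wK wS.
exists e, L; split=> // [w' /Sol0[x /optval_Sol->]//|w1 w2 w1e w2e].
have [x1 Sx1] := Sol0 _ w1e; have [x2 Sx2] := Sol0 _ w2e.
rewrite (optval_Sol Sx1) (optval_Sol Sx2) -EFinB abse_EFin lee_fin ler_norml.
have := SolL _ _ _ _ w1e w2e Sx1 Sx2; have := SolL _ _ _ _ w2e w1e Sx2 Sx1.
by rewrite (om_distC w2); lra.
Qed.

(** If upper semicontinuity failed, solutions [y n] of approaching problems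
    would stay at distance [p] from the solution [x0].  Their weak limit is
    feasible and, by the Lipschitz estimate of the value, optimal, hence equal
    to [x0]; the defect term then bounds [d / 2 * p ^+ 2] by any [e > 0].  As
    nearby problems are solvable and [Sol w] is a point, lower semicontinuity
    follows from upper semicontinuity. *)
Lemma regular_continuous w d : garding (om_T w) d -> 0 < d ->
  recession_positive w -> slater w -> is_singleton (Sol w) ->
  continuous_map_at Sol w.
Proof.
move=> gT d0 wK wS [x0 Sx0].
have [e [M [L [[e0 L0] Sol0 SolM SolL]]]] := regular_stable gT d0 wK wS.
have Sx : Sol w x0 by rewrite Sx0.
have ww : om_dist w w < e by rewrite om_dist_refl.
have usc : usc_at Sol w.
  move=> V oV SV; apply: contrapT => nusc.
  have Vx0 : V x0 by exact: SV.
  have [p p0 pV] : exists2 p, 0 < p & forall y, `|y - x0| < p -> V y.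
    have /nbhs_ballP[p p0 pV] : nbhs x0 V by exact: open_nbhs_nbhs.
    by exists p => // y yp; apply: pV; rewrite -ball_normE /= distrC.
  have ex_y n : exists wy : Omega H m * H, [/\ om_dist wy.1 w < e,
      om_dist wy.1 w < n.+1%:R^-1, Sol wy.1 wy.2 & p <= `|wy.2 - x0|].
    apply: contrapT => noy; apply: nusc.
    exists (Num.min e n.+1%:R^-1); first by rewrite lt_min e0 invr_gt0 ltr0Sn.
    move=> w'; rewrite lt_min => /andP[w'e w'n] y Sy; apply: pV.
    by rewrite ltNge; apply/negP => py; apply: noy; exists (w', y).
  pose W n := (projT1 (cid (ex_y n))).1; pose y n := (projT1 (cid (ex_y n))).2.
  have WP n : [/\ om_dist (W n) w < e, om_dist (W n) w < n.+1%:R^-1,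
    Sol (W n) (y n) & p <= `|y n - x0|] := projT2 (cid (ex_y n)).
  have [U [UU ooU]] := exists_ultra_oo.
  have FU : Filter U by apply: filter_filter.
  have yM n : `|y n| <= M by have [/SolM + _ + _] := WP n; apply.
  pose K := (1 + M) ^+ 2.
  have K0 : 0 <= K by exact: sqr_ge0.
  have yK n : om_dist (W n) w * (1 + `|y n|) ^+ 2 <= om_dist (W n) w * K.
    have M0 := le_trans (normr_ge0 _) (yM n).
    by rewrite ler_wpM2l ?om_dist_ge0// ler_pXn2r ?nnegrE ?addr_ge0// lerD2l.
  have [a a0|v [wv vb]] := weak_limit_of_approx_solutions (b := obj x0 w) UU gT yM.
    have KL0 : 0 < K + L + 1 by rewrite ltr_wpDl// addr_ge0.
    near=> n; have [We Wn Sy _] := WP n.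
    have dn : om_dist (W n) w * (K + L) <= a.
      have : om_dist (W n) w < a / (K + L + 1).
        by apply: lt_trans Wn _; near: n; apply: ooU; apply: invS_small;
           rewrite divr_gt0.
      by rewrite ltr_pdivlMr//; have := om_dist_ge0 (W n) w; lra.
    have dL : 0 <= om_dist (W n) w * L by rewrite mulr_ge0// om_dist_ge0.
    split=> [i|].
      have /SolP[/(_ i) wi _] := Sy.
      have := constr_perturb i (y n) (W n) w; rewrite ler_norml => /andP[+ _].
      by have := yK n; lra.
    have := SolL _ _ _ _ We ww Sy Sx.
    have := obj_perturb (y n) (W n) w; rewrite ler_norml => /andP[+ _].
    by have := yK n; lra.
  have vopt : obj v w <= obj x0 w.
    apply/ler_addgt0Pr => a a0; have [n] := filter_ex (vb a a0).
    have := mulr_ge0 (divr_ge0 (ltW d0) (ler0n R 2)) (sqr_ge0 `|y n - v|); lra.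
  have vx0 : v = x0.
    have /SolP[_ x0opt] := Sx.
    suff : Sol w v by rewrite Sx0.
    by apply/SolP; split=> // z /x0opt; exact: le_trans.
  have dp : 0 < d / 4 * p ^+ 2 by rewrite mulr_gt0 ?divr_gt0 ?exprn_gt0.
  have [n] := filter_ex (vb _ dp); have [_ _ _ pn] := WP n; rewrite vx0.
  have : p ^+ 2 <= `|y n - x0| ^+ 2 by rewrite ler_pXn2r ?nnegrE// ltW.
  move=> /(ler_wpM2l (ltW d0)); lra.
split=> // V oV [x [Sxx Vx]].
have [|e' e'0 e'V] := usc V oV.
  rewrite Sx0 => _ ->.
  by move: Sxx; rewrite Sx0 => <-.
exists (Num.min e e'); first by rewrite lt_min e0.
move=> w'; rewrite lt_min => /andP[/Sol0[y Sy] /e'V SV].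
by exists y; split=> //; exact: SV.
Unshelve. all: by end_near. Qed.

End Consequences.

(** * Necessity of regularity *)

Section RankOne.
Context {R : realType} {H : hilbertType R}.

(** Decreases the quadratic form of [T] by [h <v, x>^2]. *)
Definition rank_one_sub (T : H -> H) (v : H) (h : R) (x : H) : H :=
  T x - (h * '[v, x]) *: v.

Context (T : {linear H -> H}) (v : H) (h : R).

Lemma rank_one_sub_linear : linear (rank_one_sub T v h).
Proof.
move=> a x y; rewrite /rank_one_sub linearP innerDr innerZr mulrDr scalerDl.
by rewrite scalerBr scalerA opprD addrACA mulrCA.
Qed.

HB.instance Definition _ :=
  GRing.isLinear.Build R H H *:%R (rank_one_sub T v h) rank_one_sub_linear.

Lemma rank_one_sub_dist x : `|rank_one_sub T v h x - T x| <= `|h| * `|v| ^+ 2 * `|x|.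
Proof.
rewrite /rank_one_sub addrAC subrr add0r normrN normrZ normrM.
have -> : `|h| * `|v| ^+ 2 * `|x| = `|h| * (`|v| * `|x|) * `|v| by ring.
by rewrite ler_wpM2r// ler_wpM2l//; exact: cauchy_schwarz.
Qed.

Lemma rank_one_sub_continuous : continuous T -> continuous (rank_one_sub T v h).
Proof.
move=> /continuous_linear_bound[M M0 TM].
apply: bounded_linear_continuous; apply/linear_boundedP.
near=> r => x.
have := ler_normD (rank_one_sub T v h x - T x) (T x); rewrite subrK => /le_trans; apply.
apply: le_trans (lerD (rank_one_sub_dist x) (TM x)) _.
rewrite -mulrDl ler_wpM2r//; near: r; exact: nbhs_pinfty_ge.
Unshelve. all: by end_near. Qed.

Lemma rank_one_sub_self_adjoint : self_adjoint T -> self_adjoint (rank_one_sub T v h).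
Proof.
move=> Tsa x y; rewrite /rank_one_sub innerBl innerBr innerZl innerZr Tsa.
by rewrite (innerC x v); ring.
Qed.

End RankOne.

Section Necessity.
Context {R : realType} {H : hilbertType R} {m : nat}.
Implicit Types (w : Omega H m) (x v : H).

Definition shift_constraints w (a : R) : Omega H m :=
  @MkOmega R H m (om_T w) (om_c w) (om_Ti w) (om_ci w) (fun i => om_alpha w i + a)
    (om_T_continuous (o := w)) (om_T_self_adjoint w) (om_Ti_continuous (o := w))
    (om_Ti_self_adjoint w) (om_Ti_psd w).

Definition tilt_objective w (d : H) : Omega H m :=
  @MkOmega R H m (om_T w) (om_c w + d) (om_Ti w) (om_ci w) (om_alpha w)
    (om_T_continuous (o := w)) (om_T_self_adjoint w) (om_Ti_continuous (o := w))
    (om_Ti_self_adjoint w) (om_Ti_psd w).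

Definition bend_objective w (v : H) (h : R) : Omega H m :=
  @MkOmega R H m (rank_one_sub (om_T w) v h) (om_c w) (om_Ti w) (om_ci w) (om_alpha w)
    (@rank_one_sub_continuous _ _ (om_T w) v h (om_T_continuous (o := w)))
    (@rank_one_sub_self_adjoint _ _ (om_T w) v h (om_T_self_adjoint w))
    (om_Ti_continuous (o := w)) (om_Ti_self_adjoint w) (om_Ti_psd w).

Lemma dist_shift w (a : R) : 0 <= a -> om_dist (shift_constraints w a) w <= a.
Proof.
move=> a0; apply: om_dist_le => //= *; rewrite ?subrr ?normr0 ?mulr_ge0//.
by rewrite addrAC subrr add0r ger0_norm.
Qed.

Lemma dist_tilt w (d : H) : om_dist (tilt_objective w d) w <= `|d|.
Proof.
apply: om_dist_le => //= *; rewrite ?subrr ?normr0 ?mulr_ge0//.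
by rewrite addrAC subrr add0r.
Qed.

Lemma dist_bend w v (h : R) : 0 <= h ->
  om_dist (bend_objective w v h) w <= h * `|v| ^+ 2.
Proof.
move=> h0; have hv : 0 <= h * `|v| ^+ 2 by rewrite mulr_ge0// sqr_ge0.
apply: om_dist_le => //= *; rewrite ?subrr ?normr0 ?mulr_ge0//.
by rewrite -[in leRHS](ger0_norm h0) rank_one_sub_dist.
Qed.

Lemma feasible_nonempty w : optval w \is a fin_num -> exists x, feasible w x.
Proof.
move=> wfin; apply: contrapT => nox; move: wfin.
have -> : optval w = +oo%E; last by [].
rewrite /optval; suff -> : feasible w = set0 by rewrite image_set0 ereal_inf0.
by apply/seteqP; split=> // x wx; case: nox; exists x.
Qed.

Lemma quadratic_unbounded (a b c : R) : a < 0 ->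
  exists2 t, 0 <= t & a * t ^+ 2 + b * t + c < 0.
Proof.
move=> a0; pose t := 1 + (`|b| + `|c|) / - a.
have na : 0 < - a by rewrite oppr_gt0.
have t1 : 1 <= t by rewrite /t lerDl divr_ge0 ?addr_ge0// ltW.
exists t; first exact: le_trans t1.
have at_ : a * t = a - (`|b| + `|c|) by rewrite /t; field; rewrite lt_eqF.
have -> : a * t ^+ 2 = (a - (`|b| + `|c|)) * t by rewrite -at_; ring.
have := ler_norm b; have := ler_norm c; have := normr_ge0 c; have := normr_ge0 b.
clearbody t; move=> b0 c0 cc bb.
have t0 : 0 <= t by lra.
have := ler_wpM2r t0 bb; have := ler_wpM2l c0 t1.
have : a * t < 0 by rewrite nmulr_rlt0//; lra.
lra.
Qed.

Lemma obj_along_line w x v (t : R) :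
  obj (x + t *: v) w = 2^-1 * '[v, om_T w v] * t ^+ 2 +
    ('[v, om_T w x] + '[om_c w, v]) * t + obj x w.
Proof.
have Tt : om_T w (x + t *: v) = om_T w x + t *: om_T w v.
  by rewrite linearD linearZZ.
rewrite /obj Tt innerDl !innerDr !innerZl !innerZr.
by rewrite -(om_T_self_adjoint w x v) (innerC (om_T w x)); field.
Qed.

Lemma recession_feasible w x v (t : R) : feasible w x -> 0 <= t ->
  (forall i, om_Ti w i v = 0) -> (forall i, '[om_ci w i, v] <= 0) ->
  feasible w (x + t *: v).
Proof.
move=> wx t0 vT vc i; apply: le_trans (wx i).
have Tv : om_Ti w i (x + t *: v) = om_Ti w i x.
  by rewrite linearD linearZ/= vT scaler0 addr0.
have vTx : '[v, om_Ti w i x] = 0 by rewrite -om_Ti_self_adjoint vT inner0l.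
rewrite /constr Tv innerDl innerDr innerZl innerZr vTx.
have := mulr_ge0_le0 t0 (vc i); lra.
Qed.

(** A feasible point of the problem with all [alpha_i] raised is a Slater
    point of the original one. *)
Lemma finite_near_slater w (e : R) : 0 < e ->
  (forall w', om_dist w' w < e -> optval w' \is a fin_num) -> slater w.
Proof.
move=> e0 fin; have e2 : 0 < e / 2 by rewrite divr_gt0.
have [|x xP] := @feasible_nonempty (shift_constraints w (e / 2)).
  apply: fin; apply: le_lt_trans (dist_shift _ (ltW e2)) _; lra.
exists x, (e / 2); split=> // i; have := xP i; rewrite /constr/=; lra.
Qed.

(** Bending [T] along a bad direction [v] makes its quadratic form negative
    at [v], so the objective is unbounded below on the feasible half-line
    issued from [x] in the direction [v]. *)
Lemma finite_near_recession w (e : R) : 0 < e -> feasible w !=set0 ->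
  (forall w', om_dist w' w < e -> optval w' \is a fin_num) -> recession_positive w.
Proof.
move=> e0 [x wx] fin v vT vc vQ; apply: contrapT => /eqP v0.
have nv : 0 < `|v| ^+ 2 by rewrite exprn_gt0// normr_gt0.
pose h := e / 2 / `|v| ^+ 2.
have h0 : 0 < h by rewrite !divr_gt0.
pose w' := bend_objective w v h.
have /fin : om_dist w' w < e.
  by apply: le_lt_trans (dist_bend _ _ (ltW h0)) _; rewrite /h divfK ?gt_eqF//; lra.
have Qv : 2^-1 * '[v, om_T w' v] < 0.
  rewrite /= /rank_one_sub innerBr innerZr inner_norm.
  have := mulr_gt0 (mulr_gt0 h0 nv) nv.
  lra.
move=> wfin; pose r := fine (optval w').
have [t t0] := quadratic_unbounded ('[v, om_T w' x] + '[om_c w', v]) (obj x w' - r) Qv.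
rewrite addrA -obj_along_line subr_lt0; apply/negP; rewrite -leNgt -lee_fin /r fineK//.
by apply: ereal_inf_lbound; exists (x + t *: v) => //; exact: recession_feasible.
Qed.

Lemma continuous_finite_near w : optval w \is a fin_num -> optval_continuous_at w ->
  exists2 e : R, 0 < e & forall w', om_dist w' w < e -> optval w' \is a fin_num.
Proof.
move=> wfin wcont; apply: contrapT => noe.
have ex_u n : exists w', om_dist w' w < n.+1%:R^-1 /\ ~~ (optval w' \is a fin_num).
  apply: contrapT => nou; apply: noe; exists n.+1%:R^-1; first by rewrite invr_gt0.
  by move=> w' ww'; apply: contrapT => /negP nfin; apply: nou; exists w'.
pose u n := projT1 (cid (ex_u n)).
have uP n : om_dist (u n) w < n.+1%:R^-1 /\ ~~ (optval (u n) \is a fin_num) :=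
  projT2 (cid (ex_u n)).
have uw : om_cvg u w.
  apply/cvgr0Pnorm_lt => e e0; near=> n.
  rewrite ger0_norm ?om_dist_ge0//; apply: lt_trans (uP n).1 _.
  by near: n; exact: invS_small.
have := wcont u uw; rewrite -(fineK wfin) => /fine_cvgP[[N _ fin] _].
by have := (uP N).2; rewrite fin//=.
Unshelve. all: by end_near. Qed.

Lemma lipschitz_continuous w : optval_lipschitz_around w -> optval_continuous_at w.
Proof.
move=> [e [k [e0 k0 fin lip]]] u uw.
have ww : om_dist w w < e by rewrite om_dist_refl.
have [r wE] : exists r, optval w = r%:E.
  by exists (fine (optval w)); rewrite fineK//; exact: fin.
have ue : \forall n \near \oo, om_dist (u n) w < e.
  by apply: filterS (cvgr0_norm_lt _ uw _ e0) => n; rewrite ger0_norm ?om_dist_ge0.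
rewrite wE; apply/fine_cvgP; split.
  by apply: filterS ue => n; exact: fin.
apply/cvgrPdistC_lt => a a0; have k1 : 0 < k + 1 by rewrite ltr_wpDl.
near=> n; have une : om_dist (u n) w < e by near: n.
have : om_dist (u n) w < a / (k + 1).
  rewrite -[ltLHS]ger0_norm ?om_dist_ge0//; near: n.
  by apply: (cvgr0_norm_lt _ uw); rewrite divr_gt0.
have := lip _ _ une ww; rewrite wE -(fineK (fin _ une)) -EFinB abse_EFin lee_fin.
rewrite ltr_pdivlMr// => h1 h2; apply: le_lt_trans h1 _.
have := om_dist_ge0 (u n) w; lra.
Unshelve. all: by end_near. Qed.

(** If [x1] and [x2] are two solutions, add [h (x1 - x2)] to [c].  A solution
    [y] of the new problem is no better than [x2] for the old one, so it
    satisfies [<x1 - x2, y> <= <x1 - x2, x2>], and hence it stays out of an open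
    half-space that contains [x1]. *)
Lemma lsc_singleton w : Sol w !=set0 -> lsc_at Sol w -> is_singleton (Sol w).
Proof.
move=> [x1 Sx1] lsc; exists x1; apply/seteqP; split=> [x2 Sx2|_ ->//].
apply: contrapT => x21; pose d := x1 - x2.
have nd : 0 < '[d, d].
  by rewrite inner_norm exprn_gt0// normr_gt0 subr_eq0; apply/eqP => /esym/x21.
pose V := [set y : H | '[d, x2] < '[d, y]].
have oV : open V.
  rewrite openE => y yV; apply/nbhs_ballP.
  have d1 : 0 < 1 + `|d| by rewrite ltr_pwDl.
  exists (('[d, y] - '[d, x2]) / (1 + `|d|)) => [|z]/=.
    by rewrite divr_gt0// subr_gt0.
  rewrite -ball_normE/= ltr_pdivlMr// => yz; rewrite /V/=.
  have := inner_le d (y - z); rewrite innerBr; have := normr_ge0 (y - z); lra.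
have [|e e0 eV] := lsc V oV.
  by exists x1; split=> //; rewrite /V/= -subr_gt0 -innerBr.
have [h h0 hd] : exists2 h, 0 < h & om_dist (tilt_objective w (h *: d)) w < e.
  exists (e / 2 / (1 + `|d|)); first by rewrite !divr_gt0// ltr_pwDl.
  apply: le_lt_trans (dist_tilt _ _) _.
  have d1 : 0 < 1 + `|d| by rewrite ltr_pwDl.
  rewrite normrZ ger0_norm; last by rewrite !divr_ge0// ltW.
  by rewrite mulrAC ltr_pdivrMr//; have := normr_ge0 d; nra.
have [y [/SolP[wy yopt] yV]] := eV _ hd.
have /SolP[wx2 x2opt] := Sx2.
have := x2opt _ wy; have := yopt _ wx2.
rewrite /obj/= !innerDl !innerZl; move: yV; rewrite /V/= => yV.
have := mulr_gt0 h0 (_ : 0 < '[d, y] - '[d, x2]); rewrite subr_gt0 => /(_ yV).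
lra.
Qed.

End Necessity.

Theorem theorem3p2 (R : realType) (H : hilbertType R) (m : nat)
    (m_ge1 : (1 <= m)%N) (w : Omega H m)
    (T_legendre : legendre_form (fun x : H => '[x, om_T w x]))
    (Sol_neq0 : Sol w !=set0) :
  [<-> lsc_at Sol w;
       continuous_map_at Sol w;
       is_singleton (Sol w) /\ optval_lipschitz_around w;
       is_singleton (Sol w) /\ optval_continuous_at w].
Proof.
have [d d0 gT] :=
  legendre_garding (@om_T_continuous _ _ _ w) (om_T_self_adjoint w) T_legendre.
have [x0 Sx0] := Sol_neq0; have [wx0 _] := Sx0.
have wne : feasible w !=set0 by exists x0.
have regular e : 0 < e -> (forall w', om_dist w' w < e -> optval w' \is a fin_num) ->
    recession_positive w /\ slater w.
  move=> e0 fin; split; first exact: finite_near_recession fin.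
  exact: finite_near_slater fin.
have lsc_regular : lsc_at Sol w -> recession_positive w /\ slater w.
  move=> /(_ setT openT)[|e e0 eS]; first by rewrite setIT.
  by apply: (regular e) => // w' /eS[x [/optval_Sol ->]].
tfae.
- move=> lsc; have [wK wS] := lsc_regular lsc.
  by apply: (regular_continuous gT) => //; exact: lsc_singleton.
- move=> [_ lsc]; have [wK wS] := lsc_regular lsc.
  by split; [exact: lsc_singleton|exact: regular_lipschitz gT _ _ _].
- by move=> [? /lipschitz_continuous].
- move=> [S1 wcont]; have [|e e0 fin] := continuous_finite_near _ wcont.
    by rewrite (optval_Sol Sx0).
  by have [wK wS] := regular e e0 fin; have [] := regular_continuous gT d0 wK wS S1.
Qed.
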